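(* There are absolute constants $B_0,K<\infty$ such that \[ D_m\le K m^{B_0}\qquad\text{for all integers } m\ge 1 . \]
   Context: For integers $m,n\ge1$ let $\mathcal P_m(\mathbb C^n)$ be the space of $m$-homogeneous complex polynomials $P(z)=\sum_{|\alpha|=m}a_\alpha z^\alpha$ on $\mathbb C^n$ ($\alpha\in\mathbb N_0^n$). Write $\|P\|_\infty=\sup_{z\in\mathbb D^n}|P(z)|$, where $\mathbb D$ is the open unit disc, $q_m=\frac{2m}{m+1}$, and for a polynomial $Q=\sum_\nu c_\nu z^\nu$ write $\|a(Q)\|_p=(\sum_\nu|c_\nu|^p)^{1/p}$. Define \[ D_{m,n}=\sup_{0\ne P\in\mathcal P_m(\mathbb C^n)}\frac{\|a(P)\|_{q_m}}{\|P\|_\infty},\qquad D_m=\sup_{n\ge1}D_{m,n}. \] ($D_m$ is the optimal complex polynomial Bohnenblust--Hille constant; it is known that $D_m<\infty$.) *)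

(* Defs.v *)
From mathcomp Require Import all_boot all_order all_algebra.
From mathcomp Require Import mpoly complex.
From mathcomp Require Import classical_sets reals constructive_ereal ereal exp.

Set Implicit Arguments.
Unset Strict Implicit.
Unset Printing Implicit Defensive.

Import Order.TTheory GRing.Theory Num.Theory.
Import ComplexField.Normc.

Local Open Scope classical_set_scope.
Local Open Scope ring_scope.

Definition polydisc (R : realType) (n : nat) : set ('I_n -> R[i]) :=
  [set z | forall i, normc (z i) < 1].

(* [normc] is the R-valued modulus; the generic norm on R[i] is R[i]-valued.
   The supremum is over a nonempty bounded set, see [has_sup_polydisc]. *)
Definition sup_norm (R : realType) (n : nat) (P : {mpoly R[i][n]}) : R :=
  sup [set normc P.@[z] | z in @polydisc R n].

(* The coefficients outside [msupp P] are 0, so for p > 0 this is the sum over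
   all multi-indices. *)
Definition coef_norm (R : realType) (n : nat) (p : R) (P : {mpoly R[i][n]}) : R :=
  (\sum_(a <- msupp P) normc P@_a `^ p) `^ p^-1.

Definition BH_exponent (R : realType) (m : nat) : R := (2 * m)%:R / m.+1%:R.

Definition BH_const_dim (R : realType) (m n : nat) : \bar R :=
  ereal_sup [set (coef_norm (BH_exponent R m) P / sup_norm P)%:E |
             P in [set P : {mpoly R[i][n]} | P != 0 /\ P \is m.-homog]].

Definition BH_const (R : realType) (m : nat) : \bar R :=
  ereal_sup [set BH_const_dim R m n | n in [set n | (1 <= n)%N]].

Lemma has_sup_polydisc (R : realType) (n : nat) (P : {mpoly R[i][n]}) :
  has_sup [set normc P.@[z] | z in @polydisc R n].
Proof.
split.
  by exists (normc P.@[fun=> 0]), (fun=> 0) => // i; rewrite normc0.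
exists (\sum_(a <- msupp P) normc P@_a) => _ [z zD <-].
rewrite mevalE; elim: (msupp P) => [|a s IH]; first by rewrite !big_nil normc0.
rewrite !big_cons (le_trans (le_normcD _ _)) // lerD //.
have nc_ge0 (x : R[i]) : 0 <= normc x by case: x => u v; apply: sqrtr_ge0.
rewrite normcM ler_piMr //.
elim/big_ind: _ => [|x y x1 y1|i _]; first by rewrite normc1.
  by rewrite normcM mulr_ile1.
elim: (a i) => [|k IHk]; first by rewrite expr0 normc1.
by rewrite exprS normcM mulr_ile1 // ltW.
Qed.

(* Main.v *)
(* For a polynomial a in any number of variables, with homogeneous parts a_j, put
   Phi(a) = sum_j j^(-W) ||a_j||_{p_j}^2 with p_j = 2j/(j+1).  If Phi <= S on all
   polynomials bounded by 1 on the polydisc, then in fact Phi <= 4096 + S/2 on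
   them, provided that W is large enough; hence Phi <= 8192, and a single term of
   Phi bounds D_m by a power of m.  Keeping all degrees in one l^2 sum is
   what avoids a loss when a degree j is split as i + l in many ways.

   Splitting the variables in two groups turns a into a polynomial in (x, y).  Its
   part of bidegree (i, l), i + l = j, is estimated in l^{p_j} by interpolating
   between l^{p_i}(x; l^2(y)) and l^{p_l}(y; l^2(x)).  For fixed y the slice is a
   bounded polynomial in x, to which Phi <= S applies; averaging over y, an L^p-L^2
   inequality for truncations of degree at most 31 i costs only a constant factor,
   because 2 - p_i is of order 1/i.

   - Monomials all of whose exponents are < j/64 are split by most partitions into
     two parts of degree at least j/32; the weights then gain (31/32)^W.
   - If some exponent k is >= j/64, a random colouring isolates the variable v
     carrying it.  Pure powers x_v^k have l^1 norm at most 1, so only the remaining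
     degree l <= 63 j/64 enters, which gains a power of j. *)
Require Import Defs.
From mathcomp Require Import all_boot all_order all_algebra.
From mathcomp Require Import cyclic separable cyclotomic mpoly complex.
From mathcomp Require Import reals constructive_ereal exp.
From mathcomp Require Import ring lra zify.
Import Order.TTheory GRing.Theory Num.Theory.
Import ComplexField.Normc.

Set Implicit Arguments.
Unset Strict Implicit.
Unset Printing Implicit Defensive.

Local Open Scope ring_scope.

(** * Inequalities for finite sums *)

Section FiniteSums.
Context {R : realType}.
Implicit Types (x y z s a b c e : R).

(** The inequality is solved for its own best constant rather than run by induction on the degree,
    where the constant factors of the interpolation and averaging steps would accumulate. Solving it
    needs S finite beforehand; at fixed [n], [d], [J] this holds because all coefficients of a
    bounded polynomial have modulus at most 1. Origin of W = 64 (5 + 133): when an exponent at least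
    j/64 is isolated, the remaining l is at most 63 j/64, so l^(W l/j) <= j^(63 W/64), and j^(W/64)
    = j^(5 + 133) stays in the denominator. Five of these powers pay for the factor j^2 of the
    colouring, for the sum over k < j and for summability in j. The other 133 give 2^(-133), since j
    >= 2 once l >= 1. The same W makes (31/32)^W at most 2^(-133), and 133 is taken because 4^66
    2^(-133) = 1/2. *)

Lemma powR_amgm x y s : 0 <= x -> 0 <= y -> 0 <= s <= 1 ->
  x `^ s * y `^ (1 - s) <= s * x + (1 - s) * y.
Proof.
move=> x0 y0 /andP[s0 s1].
have [->|sn0] := eqVneq s 0.
  by rewrite powRr0 subr0 powRr1 // !mul1r mul0r add0r.
have [->|sn1] := eqVneq s 1.
  by rewrite powRr1 // subrr powRr0 mulr1 mul1r mul0r addr0.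
have [->|xn0] := eqVneq x 0.
  by rewrite powR0 // mul0r mulr0 add0r mulr_ge0 // subr_ge0.
have [->|yn0] := eqVneq y 0.
  by rewrite powR0 ?subr_eq0 1?eq_sym // mulr0 mulr0 addr0 mulr_ge0.
set g := _ * _.
have xp : 0 < x by rewrite lt_neqAle eq_sym xn0.
have yp : 0 < y by rewrite lt_neqAle eq_sym yn0.
have gp : 0 < g by rewrite mulr_gt0 // powR_gt0.
have gE : ln g = s * ln x + (1 - s) * ln y.
  by rewrite lnM ?posrE ?powR_gt0 // !ln_powR.
(* The tangent inequality 1 + ln r <= r at r = x/g and r = y/g; by [gE] the logarithms cancel in the
   weighted sum. *)
have key t : 0 < t -> 1 + (ln t - ln g) <= t / g.
  move=> tp; rewrite -ln_div ?posrE //.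
  have tg : 0 < t / g by rewrite divr_gt0.
  by rewrite -{2}(lnK (x := t / g)) ?posrE // expR_ge1Dx.
have kx := key _ xp; have ky := key _ yp.
rewrite -[leLHS]mul1r -ler_pdivlMr // mulrDl -!mulrA.
have := lerD (ler_wpM2l s0 kx) (ler_wpM2l (_ : 0 <= 1 - s) ky).
rewrite subr_ge0 => /(_ s1); apply: le_trans.
by rewrite gE; lra.
Qed.

Lemma sum_eq0_all (I : finType) (x : I -> R) :
  (forall i, 0 <= x i) -> \sum_i x i = 0 -> forall i, x i = 0.
Proof.
move=> x0 /eqP; rewrite psumr_eq0 // => /allP h i.
by apply/eqP/h; rewrite mem_index_enum.
Qed.

Lemma powR_div x y s : 0 <= x -> 0 <= y -> (x / y) `^ s = x `^ s / y `^ s.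
Proof.
move=> x0 y0; rewrite powRM ?invr_ge0 //; congr (_ * _).
by rewrite -powR_inv1 // -powRrM mulN1r powRN.
Qed.

Lemma holder_sum (I : finType) (x y : I -> R) s :
  (forall i, 0 <= x i) -> (forall i, 0 <= y i) -> 0 <= s <= 1 ->
  \sum_i x i `^ s * y i `^ (1 - s) <=
  (\sum_i x i) `^ s * (\sum_i y i) `^ (1 - s).
Proof.
move=> x0 y0 s01.
have [s_eq0|sn0] := eqVneq s 0.
  rewrite s_eq0 subr0 powRr0 mul1r powRr1 ?sumr_ge0 // ler_sum // => i _.
  by rewrite powRr0 mul1r powRr1.
have [s_eq1|sn1] := eqVneq s 1.
  rewrite s_eq1 subrr powRr0 mulr1 powRr1 ?sumr_ge0 // ler_sum // => i _.
  by rewrite powRr0 mulr1 powRr1.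
set X := \sum_i x i; set Y := \sum_i y i.
have X0 : 0 <= X by exact: sumr_ge0.
have Y0 : 0 <= Y by exact: sumr_ge0.
have [Xe|Xn0] := eqVneq X 0.
  rewrite big1 ?mulr_ge0 ?powR_ge0 // => i _.
  by rewrite (sum_eq0_all x0 Xe) powR0 // mul0r.
have [Ye|Yn0] := eqVneq Y 0.
  rewrite big1 ?mulr_ge0 ?powR_ge0 // => i _.
  by rewrite (sum_eq0_all y0 Ye) powR0 ?mulr0 // subr_eq0 eq_sym.
have Xp : 0 < X by rewrite lt_neqAle eq_sym Xn0.
have Yp : 0 < Y by rewrite lt_neqAle eq_sym Yn0.
have XYp : 0 < X `^ s * Y `^ (1 - s) by rewrite mulr_gt0 ?powR_gt0.
rewrite -[leRHS]mul1r -ler_pdivrMr // mulr_suml.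
apply: (@le_trans _ _ (\sum_i (s * (x i / X) + (1 - s) * (y i / Y)))).
  apply: ler_sum => i _.
  have := @powR_amgm (x i / X) (y i / Y) s _ _ s01.
  rewrite !divr_ge0 // => /(_ isT isT); apply: le_trans.
  by rewrite !powR_div // invfM mulrACA lexx.
rewrite big_split /= -!mulr_sumr -!mulr_suml -/X -/Y !divff // !mulr1.
by rewrite addrC subrK.
Qed.

(** Two applications of [holder_sum]: the first splits off x, the second separates y from z with
    relative weight b / (b + c). *)
Lemma holder_sum3 (I : finType) (x y z : I -> R) a b c :
  (forall i, 0 <= x i) -> (forall i, 0 <= y i) -> (forall i, 0 <= z i) ->
  0 < a -> 0 <= b -> 0 < c -> a + b + c = 1 ->
  \sum_i x i `^ a * y i `^ b * z i `^ c <=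
  (\sum_i x i) `^ a * (\sum_i y i) `^ b * (\sum_i z i) `^ c.
Proof.
move=> x0 y0 z0 a0 b0 c0 abc.
have bc0 : 0 < b + c by lra.
have bcE : b + c = 1 - a by lra.
pose s := b / (b + c).
have sE : 1 - s = c / (b + c) by rewrite /s; field; apply: lt0r_neq0.
have s01 : 0 <= s <= 1.
  apply/andP; split; first by rewrite divr_ge0 // ltW.
  by rewrite /s ler_pdivrMr // mul1r; lra.
have E (u v : R) : 0 <= u -> 0 <= v ->
    u `^ b * v `^ c = (u `^ s * v `^ (1 - s)) `^ (1 - a).
  move=> u0 v0; rewrite powRM ?powR_ge0 // -!powRrM sE /s -bcE.
  by rewrite -!mulrA !mulVf ?lt0r_neq0 // !mulr1.
under eq_bigr do rewrite -mulrA E //.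
apply: le_trans (holder_sum _ _ _) _ => //.
- by move=> i; rewrite mulr_ge0 ?powR_ge0.
- by apply/andP; lra.
rewrite -[leRHS]mulrA E ?sumr_ge0 // ler_wpM2l ?powR_ge0 //.
apply: ge0_ler_powR; rewrite ?nnegrE.
- by lra.
- by apply: sumr_ge0 => i _; rewrite mulr_ge0 ?powR_ge0.
- by rewrite mulr_ge0 ?powR_ge0.
- exact: holder_sum.
Qed.

(** Minkowski's inequality in l^(1/e) for the functions g(., v)^e. With A_u the inner sum, Z = sum_u
    A_u A_u^(1/e - 1) is expanded over v and Hölder is applied in u, which leaves a factor Z^(1 - e)
    to divide out. *)
Lemma minkowski_sum (U V : finType) (g : U -> V -> R) e :
  (forall u v, 0 <= g u v) -> 0 < e <= 1 ->
  (\sum_u (\sum_v g u v `^ e) `^ e^-1) `^ e <= \sum_v (\sum_u g u v) `^ e.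
Proof.
move=> g0 /andP[e0 e1].
have en0 : e != 0 by rewrite gt_eqF.
pose A u := \sum_v g u v `^ e.
have A0 u : 0 <= A u by apply: sumr_ge0 => v _; exact: powR_ge0.
set Z := \sum_u _; set W := \sum_v _.
have Z0 : 0 <= Z by apply: sumr_ge0 => u _; exact: powR_ge0.
have W0 : 0 <= W by apply: sumr_ge0 => u _; exact: powR_ge0.
have [->|Zn0] := eqVneq Z 0; first by rewrite powR0.
have Zp : 0 < Z by rewrite lt_neqAle eq_sym Zn0.
have : Z <= W * Z `^ (1 - e).
  have ZE : Z = \sum_v \sum_u g u v `^ e * (A u `^ e^-1) `^ (1 - e).
    rewrite exchange_big; apply: eq_bigr => u _; rewrite -mulr_suml -/(A u).
    rewrite -powRrM mulrBr mulr1 mulVf //.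
    have [->|An0] := eqVneq (A u) 0.
      by rewrite powR0 ?invr_eq0 // mul0r.
    by rewrite mulrC -[X in _ * X]powRr1 // -powRD ?subrK // An0 implybT.
  rewrite {1}ZE /W mulr_suml; apply: ler_sum => v _.
  apply: le_trans (holder_sum _ _ _) _ => //; first by move=> u; exact: powR_ge0.
  by rewrite ltW.
rewrite -ler_pdivrMr ?powR_gt0 // => h; apply: le_trans h.
have -> : Z / Z `^ (1 - e) = Z `^ 1 / Z `^ (1 - e) by rewrite powRr1.
rewrite -powRB; last by rewrite Zn0 implybT.
by rewrite opprB addrC subrK.
Qed.

Lemma powR_sum_le (I : finType) (x : I -> R) e :
  (forall i, 0 <= x i) -> 0 < e <= 1 ->
  (\sum_i x i) `^ e^-1 <= #|I|%:R `^ (e^-1 - 1) * \sum_i x i `^ e^-1.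
Proof.
move=> x0 /andP[e0 e1].
have en0 : e != 0 by rewrite gt_eqF.
have S0 : 0 <= \sum_i x i `^ e^-1 by apply: sumr_ge0 => i _; exact: powR_ge0.
have h : \sum_i x i <= (\sum_i x i `^ e^-1) `^ e * #|I|%:R `^ (1 - e).
  have -> : #|I|%:R = \sum_(i : I) (1 : R) by rewrite sumr_const.
  apply: le_trans (holder_sum _ _ _) => //; last by rewrite ltW.
    apply: ler_sum => i _.
    by rewrite powR1 mulr1 -powRrM mulVf // powRr1.
  by move=> i; exact: powR_ge0.
have := @ge0_ler_powR _ e^-1 _ _ _ _ _ h; rewrite !nnegrE.
rewrite invr_ge0 ltW // sumr_ge0 // mulr_ge0 ?powR_ge0 // => /(_ isT isT isT).
move=> /le_trans; apply.
rewrite powRM ?powR_ge0 // -!powRrM mulfV // powRr1 // mulrC.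
by rewrite mulrBl mul1r mulfV.
Qed.

End FiniteSums.

(* Half of the exponent p_j = 2j/(j+1): below, powers are taken of squared
   moduli. *)
Definition hexp (R : realType) (j : nat) : R := j%:R / j.+1%:R.

Lemma eq_ler (R : realType) (x y : R) : x = y -> x <= y.
Proof. by move=> ->. Qed.

Section HalfExponent.
Context {R : realType}.
Local Notation hexp := (hexp R).

Lemma hexp_ge0 j : 0 <= hexp j.
Proof. exact: divr_ge0. Qed.

Lemma hexp_gt0 j : (0 < j)%N -> 0 < hexp j.
Proof. by move=> j0; rewrite divr_gt0 ?ltr0n. Qed.

Lemma hexp_le1 j : hexp j <= 1.
Proof. by rewrite ler_pdivrMr ?ltr0n // mul1r ler_nat. Qed.

Lemma hexp_itv j : (0 < j)%N -> 0 < hexp j <= 1.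
Proof. by move=> j0; rewrite hexp_gt0 // hexp_le1. Qed.

Lemma hexpV j : (0 < j)%N -> (hexp j)^-1 = 1 + j%:R^-1.
Proof.
move=> j0; rewrite invf_div -natr1 mulrDl mul1r divff //.
by rewrite pnatr_eq0 -lt0n.
Qed.

(** Hölder in v, Hölder in u, then [minkowski_sum] to exchange the two sums in the second factor.
    With g a squared modulus this interpolates l^(p_j) between two mixed norms; the integer outer
    powers clear the denominators of the exponents. *)
Lemma mixed_sum_le (U V : finType) (g : U -> V -> R) i l :
  (forall u v, 0 <= g u v) -> (0 < i)%N -> (0 < l)%N ->
  (\sum_u \sum_v g u v `^ hexp (i + l)) ^+ (i + l).+1 <=
  (\sum_u (\sum_v g u v) `^ hexp i) ^+ i.+1 *
  (\sum_v (\sum_u g u v) `^ hexp l) ^+ l.+1.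
Proof.
move=> g0 i0 l0; set j := (i + l)%N.
have j1n0 : j.+1%:R != 0 :> R by rewrite pnatr_eq0.
have i1n0 : i.+1%:R != 0 :> R by rewrite pnatr_eq0.
have l1n0 : l.+1%:R != 0 :> R by rewrite pnatr_eq0.
have ln0 : l%:R != 0 :> R by rewrite pnatr_eq0 -lt0n.
have jE : j%:R = i%:R + l%:R :> R by rewrite natrD.
(* The inner Hölder weight solves hexp j = s + (1 - s) hexp l; the outer weight t below solves s = t
   hexp i. *)
pose s : R := i%:R / j.+1%:R.
have sE : 1 - s = l.+1%:R / j.+1%:R.
  by rewrite /s -[l.+1%:R]natr1 -[j.+1%:R]natr1 jE in j1n0 *; field.
have s01 : 0 <= s <= 1.
  by rewrite divr_ge0 //= ler_pdivrMr ?ltr0n // mul1r ler_nat /j; lia.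
pose t : R := i.+1%:R / j.+1%:R.
have tE : 1 - t = l%:R / j.+1%:R.
  rewrite /t -[i.+1%:R]natr1 -[j.+1%:R]natr1 jE in j1n0 *; field.
  by [].
have t01 : 0 <= t <= 1.
  by rewrite divr_ge0 //= ler_pdivrMr ?ltr0n // mul1r ler_nat /j; lia.
set T := \sum_u _; set X := \sum_u _; set Y := \sum_v _.
have X0 : 0 <= X by apply: sumr_ge0 => u _; exact: powR_ge0.
have Y0 : 0 <= Y by apply: sumr_ge0 => u _; exact: powR_ge0.
have T0 : 0 <= T.
  by apply: sumr_ge0 => u _; apply: sumr_ge0 => v _; exact: powR_ge0.
pose G u := \sum_v g u v; pose A u := \sum_v g u v `^ hexp l.
have G0 u : 0 <= G u by exact: sumr_ge0.
have A0 u : 0 <= A u by apply: sumr_ge0 => v _; exact: powR_ge0.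
pose Z := \sum_u A u `^ (hexp l)^-1.
have Z0 : 0 <= Z by apply: sumr_ge0 => u _; exact: powR_ge0.
have TX : T <= X `^ t * Y `^ (l.+1%:R / j.+1%:R).
  apply: (@le_trans _ _ (X `^ t * Z `^ (1 - t))); last first.
    apply: ler_wpM2l; first exact: powR_ge0.
    have -> : 1 - t = hexp l * (l.+1%:R / j.+1%:R).
      by rewrite tE /hexp; field; rewrite !nat1r j1n0 l1n0.
    rewrite powRrM; apply: ge0_ler_powR; rewrite ?nnegrE ?powR_ge0 ?divr_ge0 //.
    by apply: minkowski_sum => //; exact: hexp_itv.
  apply: le_trans (holder_sum _ _ t01).
  - apply: ler_sum => u _.
    apply: (@le_trans _ _ (G u `^ s * A u `^ (1 - s))); last first.
      rewrite -!powRrM; apply: eq_ler; congr (_ `^ _ * _ `^ _).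
        by rewrite /s /hexp /t; field; rewrite !nat1r j1n0 i1n0.
      by rewrite sE tE /hexp; field; rewrite !nat1r j1n0 l1n0 ln0.
    apply: le_trans (holder_sum _ _ s01) => //; last by move=> v; exact: powR_ge0.
    apply: ler_sum => v _; apply: eq_ler.
    rewrite -powRrM -powRD; last first.
      apply/implyP => /eqP h; exfalso; move: h; apply/eqP/lt0r_neq0.
      rewrite sE addr_gt0 ?mulr_gt0 ?invr_gt0 ?ltr0n //.
    congr (_ `^ _); rewrite sE /s /hexp jE; field.
    by rewrite !nat1r j1n0 l1n0.
  - by move=> u; exact: powR_ge0.
  - by move=> u; exact: powR_ge0.
have h : T ^+ j.+1 <= (X `^ t * Y `^ (l.+1%:R / j.+1%:R)) ^+ j.+1.
  by apply: lerXn2r TX; rewrite nnegrE // mulr_ge0 ?powR_ge0.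
apply: le_trans h _; rewrite exprMn -!powR_mulrn ?powR_ge0 // -!powRrM.
by rewrite /t !divfK // !powR_mulrn.
Qed.

End HalfExponent.

(** * Roots of unity and moments on the torus *)

Section Modulus.
Context {R : realType}.
Local Notation C := (R[i]).
Implicit Types z w : C.

Lemma normc_ge0 z : 0 <= normc z.
Proof. by case: z => x y; exact: sqrtr_ge0. Qed.

Lemma normcE z : `|z| = (normc z)%:C%C.
Proof. by case: z. Qed.

Lemma normc_sum (I : Type) (r : seq I) (P : pred I) (F : I -> C) :
  normc (\sum_(i <- r | P i) F i) <= \sum_(i <- r | P i) normc (F i).
Proof.
elim/big_rec2: _ => [|i x y _ le_xy]; first by rewrite normc0.
by rewrite (le_trans (le_normcD _ _)) // lerD2l.
Qed.

Lemma normcX z k : normc (z ^+ k) = normc z ^+ k.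
Proof. by elim: k => [|k IH]; rewrite ?expr0 ?normc1 // !exprS normcM IH. Qed.

Lemma normc_real (x : R) : 0 <= x -> normc (x%:C)%C = x.
Proof. by move=> x0; rewrite /normc /= expr0n addr0 sqrtr_sqr ger0_norm. Qed.

Lemma normc_nat k : normc (k%:R : C) = k%:R.
Proof. by rewrite -(rmorph_nat (@real_complex R)) normc_real. Qed.

Lemma normc_conj z : normc z^* = normc z.
Proof. by apply: complexI; rewrite -!normcE norm_conjC. Qed.

Definition sqm z : R := normc z ^+ 2.

Lemma sqm_ge0 z : 0 <= sqm z. Proof. exact: sqr_ge0. Qed.

Lemma sqmE z : (sqm z)%:C%C = z * z^*.
Proof. by rewrite rmorphXn /= -normcE normCK. Qed.

Lemma sqmM z w : sqm (z * w) = sqm z * sqm w.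
Proof. by rewrite /sqm normcM exprMn. Qed.

Lemma sqm0 : sqm 0 = 0.
Proof. by rewrite /sqm normc0 expr0n. Qed.

Lemma sqm_powR z (e : R) : sqm z `^ e = normc z `^ (2 * e).
Proof. by rewrite /sqm -powR_mulrn ?normc_ge0 // -powRrM. Qed.

Lemma normc_root_unity z k : (0 < k)%N -> z ^+ k = 1 -> normc z = 1.
Proof.
move=> k0 /(congr1 (@normc R)); rewrite normcX normc1 => /eqP.
by rewrite pexpr_eq1 ?normc_ge0 // => /eqP.
Qed.

Lemma prim_root_exists k : (0 < k)%N -> exists z : C, k.-primitive_root z.
Proof.
pose p : {poly C} := 'X^k - 1; have [r Dp] := closed_field_poly_normal p.
move=> k0; rewrite (monicP _) ?monicXnsubC // scale1r in Dp.
have rn1 : all k.-unity_root r by apply/allP=> z; rewrite -root_prod_XsubC -Dp.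
have sz_r : (k < (size r).+1)%N.
  by rewrite -(size_prod_XsubC r id) -Dp size_XnsubC.
have [|z] := hasP (has_prim_root k0 rn1 _ sz_r); last by exists z.
by rewrite -separable_prod_XsubC -Dp separable_Xn_sub_1 // pnatr_eq0 -lt0n.
Qed.

Lemma sum_root_unity (w : C) k a b : k.-primitive_root w ->
  \sum_(t < k) (w ^+ t) ^+ a * ((w ^+ t) ^+ b)^* =
  (k * (a == b %[mod k]))%:R.
Proof.
move=> pw; have k0 := prim_order_gt0 pw; have wk := prim_expr_order pw.
have wu : normc w = 1 by exact: normc_root_unity wk.
have w0 : w != 0.
  by apply: contraTneq (oner_neq0 R) => w0; rewrite -wu w0 normc0 eqxx.
have cw : w^* = w^-1.
  by apply: (mulfI w0); rewrite mulfV // -sqmE /sqm wu expr1n.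
pose q := w ^+ a * w^-1 ^+ b.
have -> : \sum_(t < k) (w ^+ t) ^+ a * ((w ^+ t) ^+ b)^* = \sum_(t < k) q ^+ t.
  apply: eq_bigr => t _; rewrite !rmorphXn /= cw /q exprMn -!exprM.
  by rewrite ![(t * _)%N]mulnC.
have qk : q ^+ k = 1.
  by rewrite /q exprMn -!exprM ![(_ * k)%N]mulnC !exprM wk exprVn wk invr1 !expr1n mulr1.
have qE : (q == 1) = (a == b %[mod k]).
  rewrite -(eq_prim_root_expr pw) /q exprVn.
  rewrite -subr_eq0 -[RHS]subr_eq0 -(mulIr_eq0 _ (mulIf (expf_neq0 b w0))).
  by rewrite mulrBl mulfVK ?expf_neq0 // mul1r.
rewrite -qE; have [->|qn1] := eqVneq q 1.
  by under eq_bigr do rewrite expr1n; rewrite sumr_const card_ord muln1.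
rewrite muln0; apply: (mulfI (_ : q - 1 != 0)); first by rewrite subr_eq0.
by rewrite -subrX1 qk subrr mulr0.
Qed.

End Modulus.

Section Torus.
Context {R : realType}.
Local Notation C := (R[i]).

Definition mon (n : nat) (z : 'I_n -> C) (u : 'I_n -> nat) : C :=
  \prod_v z v ^+ u v.

Lemma monD n (z : 'I_n -> C) (u w : 'I_n -> nat) :
  mon z (fun v => u v + w v)%N = mon z u * mon z w.
Proof. by rewrite /mon -big_split; apply: eq_bigr => v _; rewrite exprD. Qed.

Definition deg (n : nat) (u : 'I_n -> nat) : nat := \sum_v u v.

(** A point of the grid of N-th roots of unity. Averages over this grid replace integrals over the
    torus: monomials are exactly orthogonal as long as all exponents are below N. *)
Definition tpt (n N : nat) (w : C) (y : {ffun 'I_n -> 'I_N}) (v : 'I_n) : C :=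
  w ^+ y v.

Lemma sum_torus_prod n N (w : C) (f : 'I_n -> C -> C) :
  \sum_(y : {ffun 'I_n -> 'I_N}) \prod_v f v (tpt w y v) =
  \prod_v \sum_(t < N) f v (w ^+ t).
Proof. by rewrite bigA_distr_bigA. Qed.

Section Prim.
Variables (n N : nat) (w : C).
Hypothesis pw : N.-primitive_root w.
Local Notation Y := {ffun 'I_n -> 'I_N}.

Lemma tpt_norm (y : Y) v : normc (tpt w y v) = 1.
Proof.
apply: (normc_root_unity (prim_order_gt0 pw)).
by rewrite /tpt exprAC (prim_expr_order pw) expr1n.
Qed.

Lemma sum_mon (u1 u2 : 'I_n -> nat) :
  (forall v, u1 v < N)%N -> (forall v, u2 v < N)%N ->
  \sum_(y : Y) mon (tpt w y) u1 * (mon (tpt w y) u2)^* =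
  (N ^ n * [forall v, u1 v == u2 v])%:R.
Proof.
move=> u1N u2N.
under eq_bigr do rewrite /mon rmorph_prod -big_split /=.
rewrite (sum_torus_prod _ _ (fun v z => z ^+ u1 v * (z ^+ u2 v)^*)).
under eq_bigr do rewrite (sum_root_unity _ _ pw) !modn_small // natrM.
rewrite big_split /= prodr_const card_ord natrM natrX; congr (_ * _).
case: forallP => [h|/forallP]; first by rewrite big1 // => v _; rewrite h.
by rewrite negb_forall => /existsP[v /negbTE h]; rewrite (bigD1 v) //= h mul0r.
Qed.

(** The right side keeps all coincidences of exponents: [fourth_moment] applies it to families
    indexed by pairs, where they are the quantity to be counted. *)
Lemma parseval (A B : finType) (ea : A -> 'I_n -> nat) (eb : B -> 'I_n -> nat)
    (f : A -> C) (g : B -> C) :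
  (forall a v, ea a v < N)%N -> (forall b v, eb b v < N)%N ->
  \sum_(y : Y) (\sum_a f a * mon (tpt w y) (ea a)) *
    (\sum_b g b * mon (tpt w y) (eb b))^* =
  (N ^ n)%:R *
    \sum_a \sum_b (f a * (g b)^*) *+ [forall v, ea a v == eb b v].
Proof.
move=> eaN ebN.
transitivity (\sum_a \sum_b f a * (g b)^* *
   \sum_(y : Y) mon (tpt w y) (ea a) * (mon (tpt w y) (eb b))^*).
  under [RHS]eq_bigr do under eq_bigr do rewrite mulr_sumr.
  under [RHS]eq_bigr do rewrite exchange_big /=.
  rewrite [RHS]exchange_big /=; apply: eq_bigr => y _.
  rewrite rmorph_sum mulr_suml; apply: eq_bigr => a _.
  rewrite mulr_sumr; apply: eq_bigr => b _; rewrite rmorphM; ring.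
rewrite mulr_sumr; apply: eq_bigr => a _; rewrite mulr_sumr.
apply: eq_bigr => b _; rewrite sum_mon //.
by case: [forall v, _]; rewrite ?muln1 ?muln0 ?mulr1n ?mulr0n ?mulr0 1?mulrC.
Qed.

End Prim.

(** There are prod (u_v + 1) multi-indices below u, and k + 1 <= 2^k. *)
Lemma card_below (n : nat) (A : finType) (e : A -> 'I_n -> nat)
    (u : 'I_n -> nat) :
  (forall a b, e a =1 e b -> a = b) ->
  (#|[pred a | [forall v, e a v <= u v]]| <= 2 ^ deg u)%N.
Proof.
move=> inj_e; pose K := (\max_v u v).+1.
have uK v : (u v < K)%N by rewrite ltnS leq_bigmax.
pose h a : {ffun 'I_n -> 'I_K} := [ffun v => inord (e a v)].
have hE a v : (e a v <= u v)%N -> h a v = e a v :> nat.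
  by move=> le_eu; rewrite ffunE inordK // (leq_ltn_trans le_eu).
have inj_h : {in [pred a | [forall v, e a v <= u v]%N] &, injective h}.
  move=> a b; rewrite !inE => /forallP ha /forallP hb hab.
  by apply: inj_e => v; rewrite -hE // hab hE.
rewrite -(card_in_image inj_h).
apply: (@leq_trans #|family (fun v => [pred k : 'I_K | k <= u v]%N)|).
  apply/subset_leq_card/subsetP => _ /imageP[a ha ->].
  by apply/familyP => v; rewrite inE hE //; move: ha; rewrite inE => /forallP.
rewrite card_family /deg /image_mem foldrE big_map big_enum /=.
rewrite expn_sum; apply: leq_prod => v _.
have -> : #|[pred k : 'I_K | (k <= u v)%N]| = (u v).+1.
  rewrite -sum1_card -[RHS]card_ord -[RHS]sum1_card.
  rewrite (big_ord_widen K (fun=> 1%N) (uK v)).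
  by apply: eq_bigl => k; rewrite inE ltnS.
exact: ltn_expl.
Qed.

End Torus.

(** * Comparison of moments for polynomials of bounded degree *)

Section Hyper.
Context {R : realType}.
Local Notation C := (R[i]).
Variables (n N : nat) (w : C).
Hypothesis pw : N.-primitive_root w.
Local Notation Y := {ffun 'I_n -> 'I_N}.
Variables (A : finType) (e : A -> 'I_n -> nat).
Hypothesis inj_e : forall a b, e a =1 e b -> a = b.
(** Doubled exponents stay below N, so that products of two monomials are still orthogonal. *)
Hypothesis eN : forall a v, (e a v + e a v < N)%N.

Definition lincomb (f : A -> C) (z : 'I_n -> C) : C := \sum_a f a * mon z (e a).

Let eN1 a v : (e a v < N)%N.
Proof. by apply: leq_ltn_trans (eN a v); rewrite leq_addr. Qed.

Let eeq a b : [forall v, e a v == e b v] = (a == b).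
Proof.
apply/forallP/eqP => [h|-> //]; apply: inj_e => v; exact/eqP/h.
Qed.

Lemma parseval_inj (f g : A -> C) :
  \sum_(y : Y) lincomb f (tpt w y) * (lincomb g (tpt w y))^* =
  (N ^ n)%:R * \sum_a f a * (g a)^*.
Proof.
rewrite (parseval pw) //; congr (_ * _); apply: eq_bigr => a _.
rewrite (bigD1 a) //= eeq eqxx mulr1n big1 ?addr0 // => b ba.
by rewrite eeq eq_sym (negbTE ba).
Qed.

Lemma sum_sqm_lincomb (f : A -> C) :
  \sum_(y : Y) sqm (lincomb f (tpt w y)) = (N ^ n)%:R * \sum_a sqm (f a).
Proof.
apply: complexI; rewrite rmorphM !rmorph_sum rmorph_nat /=.
under eq_bigr do rewrite sqmE.
by rewrite parseval_inj; under [in RHS]eq_bigr do rewrite sqmE.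
Qed.

(* Expanding |S|^4 = |S^2|^2 by orthogonality, the number of factorizations of
   a monomial of degree at most 2D as a product of two is at most 2^(2D). *)
Lemma fourth_moment (D : nat) (s : A -> C) :
  (forall a, s a != 0 -> (deg (e a) <= D)%N) ->
  \sum_(y : Y) sqm (lincomb s (tpt w y)) ^+ 2 <=
  (N ^ n)%:R * (4 ^+ D * (\sum_a sqm (s a)) ^+ 2).
Proof.
move=> sD.
pose P (p : A * A) := s p.1 * s p.2.
pose E (p : A * A) v := (e p.1 v + e p.2 v)%N.
have EN p v : (E p v < N)%N.
  have := eN p.1 v; have := eN p.2 v; rewrite /E; lia.
have sqE z : lincomb s z ^+ 2 = \sum_p P p * mon z (E p).
  rewrite expr2 /lincomb mulr_suml.
  under eq_bigr do rewrite mulr_sumr.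
  rewrite pair_bigA; apply: eq_bigr => p _ /=.
  by rewrite /P /E monD; ring.
pose c p q : bool := [forall v, E p v == E q v].
have cC p q : c p q = c q p by apply: eq_forallb => v; rewrite eq_sym.
have -> : \sum_(y : Y) sqm (lincomb s (tpt w y)) ^+ 2 =
    normc ((N ^ n)%:R * \sum_p \sum_q (P p * (P q)^*) *+ c p q).
  rewrite -(parseval pw P P EN EN) -[LHS]normc_real; last first.
    by apply: sumr_ge0 => y _; exact: sqr_ge0.
  congr normc; rewrite rmorph_sum; apply: eq_bigr => y _.
  by rewrite -sqE -sqmE [in RHS]/sqm normcX exprAC.
rewrite normcM normc_nat ler_wpM2l //.
(* Cross terms are bounded by |xy| <= (|x|^2 + |y|^2)/2; the symmetry of [c] merges the two
   halves. *)
apply: (@le_trans _ _ (\sum_p \sum_q sqm (P p) *+ c p q)).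
  apply: (@le_trans _ _
      (\sum_p \sum_q (sqm (P p) + sqm (P q)) / 2 *+ c p q)).
    apply: le_trans (normc_sum _ _ _) _; apply: ler_sum => p _.
    apply: le_trans (normc_sum _ _ _) _; apply: ler_sum => q _.
    case: (c p q); rewrite ?mulr1n ?mulr0n ?normc0 //.
    rewrite normcM normc_conj /sqm ler_pdivlMr //.
    by have := sqr_ge0 (normc (P p) - normc (P q)); nra.
  have -> : \sum_p \sum_q (sqm (P p) + sqm (P q)) / 2 *+ c p q =
     \sum_p \sum_q (sqm (P p) / 2 *+ c p q) + 
     \sum_p \sum_q (sqm (P q) / 2 *+ c p q).
    rewrite -big_split; apply: eq_bigr => p _; rewrite -big_split.
    by apply: eq_bigr => q _; rewrite mulrDl mulrnDl.
  rewrite [X in _ + X]exchange_big /= -big_split /= ler_sum // => p _.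
  rewrite -big_split /= ler_sum // => q _; rewrite cC -mulrnDl.
  by rewrite -splitr.
have -> : 4 ^+ D * (\sum_a sqm (s a)) ^+ 2 = \sum_p sqm (P p) * 4 ^+ D.
  rewrite -mulr_suml mulrC; congr (_ * _).
  rewrite expr2 mulr_suml; under eq_bigr do rewrite mulr_sumr.
  by rewrite pair_bigA; apply: eq_bigr => p _; rewrite /P sqmM.
apply: ler_sum => p _.
have [P0|Pn0] := eqVneq (P p) 0.
  by rewrite P0 sqm0 mul0r big1 // => q _; rewrite mul0rn.
have [s1 s2] : s p.1 != 0 /\ s p.2 != 0.
  by apply/andP; rewrite -negb_or -mulf_eq0.
under eq_bigr do rewrite -mulr_natr.
rewrite -mulr_sumr ler_wpM2l ?sqm_ge0 // -natr_sum.
have -> : 4 ^+ D = (4 ^ D)%:R :> R by rewrite natrX.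
rewrite ler_nat; have -> : (4 ^ D = 2 ^ (D + D))%N by rewrite addnn -mul2n expnM.
have -> : (\sum_q c p q = #|[pred q | c p q]|)%N.
  rewrite -sum1_card [RHS]big_mkcond; apply: eq_bigr => q _.
  by rewrite inE; case: (c p q).
(* A factorization of a monomial is determined by its first factor, which divides the monomial. *)
apply: (@leq_trans #|[pred a | [forall v, e a v <= E p v]%N]|).
  have inj1 : {in [pred q | c p q] &, injective (@fst A A)}.
    move=> [q1 q2] [r1 r2]; rewrite !inE /= => /forallP hq /forallP hr qr.
    congr pair => //; apply: inj_e => v; move: (hq v) (hr v).
    by rewrite /E /= qr => /eqP -> /eqP/addnI.
  rewrite -(card_in_image inj1); apply/subset_leq_card/subsetP => a.
  move=> /imageP[q]; rewrite !inE => /forallP hq ->; apply/forallP => v.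
  by rewrite (eqP (hq v)) leq_addr.
apply: leq_trans (card_below _ inj_e) _; rewrite leq_exp2l //.
by rewrite /deg big_split /= leq_add // sD.
Qed.

Let avg (f : Y -> R) := (\sum_y f y) / (N ^ n)%:R.

Let Nn0 : 0 < (N ^ n)%:R :> R.
Proof. by rewrite ltr0n expn_gt0 (prim_order_gt0 pw). Qed.

Lemma avg_holder3 (x y z : Y -> R) (a b c : R) :
  (forall i, 0 <= x i) -> (forall i, 0 <= y i) -> (forall i, 0 <= z i) ->
  0 < a -> 0 <= b -> 0 < c -> a + b + c = 1 ->
  avg (fun i => x i `^ a * y i `^ b * z i `^ c) <=
  avg x `^ a * avg y `^ b * avg z `^ c.
Proof.
move=> x0 y0 z0 a0 b0 c0 abc.
rewrite /avg !powR_div ?sumr_ge0 ?(ltW Nn0) //.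
have K (M : R) : 0 < M -> M = M `^ a * M `^ b * M `^ c.
  by move=> M0; rewrite -!powRD ?(gt_eqF M0) ?implybT // abc powRr1 // ltW.
rewrite ler_pdivrMr // [X in _ * X]K //.
apply: le_trans (holder_sum3 x0 y0 z0 a0 b0 c0 abc) _.
rewrite le_eqVlt; apply/orP; left; apply/eqP.
have h q : (N ^ n)%:R `^ q != 0 :> R by rewrite gt_eqF // powR_gt0.
by field; rewrite !h.
Qed.

(* Duality: with S the truncation of f, the second moment of S is the mean of
   f conj(S), to which Hölder with exponents p, 2 and 4 applies. *)
Lemma truncation_moment (D i : nat) (f s : A -> C) : (1 < i)%N ->
  (forall a, s a = f a \/ s a = 0) ->
  (forall a, s a != 0 -> (deg (e a) <= D)%N) ->
  (\sum_a sqm (s a)) ^+ i <=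
  4 ^+ D * avg (fun y => sqm (lincomb f (tpt w y)) `^ hexp R i) ^+ i.+1.
Proof.
move=> i1 sf sD; set m2 := \sum_a sqm (s a); set mp := avg _.
have m20 : 0 <= m2 by apply: sumr_ge0 => a _; exact: sqm_ge0.
have mp0 : 0 <= mp.
  by rewrite divr_ge0 // sumr_ge0 // => y _; exact: powR_ge0.
have [->|m2n0] := eqVneq m2 0.
  rewrite expr0n gtn_eqF ?(ltnW i1) // mulr_ge0 ?exprn_ge0 //.
have m2p : 0 < m2 by rewrite lt_neqAle eq_sym m2n0.
have i0 : 0 < i%:R :> R by rewrite ltr0n ltnW.
have in0 : i%:R != 0 :> R by rewrite gt_eqF.
have i10 : i.+1%:R != 0 :> R by rewrite pnatr_eq0.
pose F (y : Y) := lincomb f (tpt w y); pose S (y : Y) := lincomb s (tpt w y).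
have m2E : m2 <= avg (fun y => normc (F y) * normc (S y)).
  rewrite ler_pdivlMr // mulrC.
  have -> : (N ^ n)%:R * m2 = normc (\sum_y F y * (S y)^*).
    rewrite parseval_inj -[LHS]normc_real ?mulr_ge0 // rmorphM rmorph_nat.
    congr (normc (_ * _)); rewrite rmorph_sum; apply: eq_bigr => a _.
    by rewrite /= sqmE; case: (sf a) => ->; rewrite ?rmorph0 ?mulr0.
  apply: le_trans (normc_sum _ _ _) _.
  by apply: ler_sum => y _; rewrite normcM normc_conj.
(* The weights are forced: 1/a = p_i because F enters to the power 1, 2 b + 4 c = 1 because S does,
   and a + b + c = 1. Here i >= 2 gives b >= 0. *)
pose a : R := i.+1%:R / (2 * i%:R).
pose b : R := (i%:R - 2) / (2 * i%:R).
pose c : R := (2 * i%:R)^-1.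
have a0 : 0 < a by rewrite divr_gt0 ?ltr0n // mulr_gt0.
have b0 : 0 <= b by rewrite divr_ge0 ?mulr_ge0 ?(ltW i0) // subr_ge0 ler_nat.
have c0 : 0 < c by rewrite invr_gt0 mulr_gt0.
have abc : a + b + c = 1 by rewrite /a /b /c -natr1; field.
have h := @avg_holder3 (fun y => sqm (F y) `^ hexp R i) (fun y => sqm (S y))
  (fun y => sqm (S y) ^+ 2) a b c (fun=> powR_ge0 _ _) (fun=> sqm_ge0 _)
  (fun=> sqr_ge0 _) a0 b0 c0 abc.
have {}h : m2 <= mp `^ a * m2 `^ b * (4 ^+ D * m2 ^+ 2) `^ c.
  apply: le_trans m2E _.
  have -> : avg (fun y => normc (F y) * normc (S y)) =
      avg (fun i0 => (sqm (F i0) `^ hexp R i) `^ a * sqm (S i0) `^ b *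
        (sqm (S i0) ^+ 2) `^ c).
    congr (_ / _); apply: eq_bigr => y _.
    rewrite -powRrM -[sqm (S y) ^+ 2]powR_mulrn ?sqm_ge0 // -[in RHS]powRrM.
    rewrite -mulrA -powRD; last first.
      by apply/implyP => /eqP bc0; move: abc; rewrite -addrA; nra.
    rewrite !sqm_powR.
    have -> : 2 * (hexp R i * a) = 1.
      by rewrite /a /hexp; field; rewrite nat1r i10 in0.
    have -> : 2 * (b + 2 * c) = 1 by rewrite /b /c; field.
    by rewrite !powRr1 ?normc_ge0.
  apply: le_trans h _.
  have -> : avg (fun y => sqm (S y)) = m2.
    by rewrite /avg /S sum_sqm_lincomb mulrC mulKf // gt_eqF.
  rewrite ler_wpM2l ?mulr_ge0 ?powR_ge0 //.
  apply: ge0_ler_powR; rewrite ?nnegrE.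
  - exact: ltW.
  - by rewrite divr_ge0 // sumr_ge0 // => y _; exact: sqr_ge0.
  - by rewrite mulr_ge0 ?exprn_ge0.
  - by rewrite ler_pdivrMr // mulrC; exact: fourth_moment.
clear m2E; clearbody mp m2.
have h2 : m2 ^+ (2 * i) <= (mp `^ a * m2 `^ b * (4 ^+ D * m2 ^+ 2) `^ c) ^+ (2 * i).
  by apply: lerXn2r h; rewrite nnegrE // !mulr_ge0 ?powR_ge0.
have E x q : 0 <= x -> x `^ q ^+ (2 * i) = x `^ (q * (2 * i)%:R) :> R.
  by move=> x0; rewrite -powR_mulrn ?powR_ge0 // -powRrM.
have m4 : 0 <= 4 ^+ D * m2 ^+ 2 by rewrite mulr_ge0 ?exprn_ge0.
move: h2; rewrite !exprMn !E // natrM.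
have -> : a * (2 * i%:R) = i.+1%:R by rewrite /a; field.
have -> : b * (2 * i%:R) = (i - 2)%:R by rewrite natrB // /b; field.
have -> : c * (2 * i%:R) = 1 by rewrite /c; field.
rewrite !powR_mulrn // powRr1 // => h2.
(* The 2i-th power of the estimate is m2^(2i) <= 4^D mp^(i+1) m2^i, and m2^i cancels. *)
rewrite -(ler_pM2r (exprn_gt0 i m2p)) -exprD addnn -mul2n.
apply: le_trans h2 _; rewrite le_eqVlt; apply/orP; left; apply/eqP.
have -> : m2 ^+ i = m2 ^+ (i - 2) * m2 ^+ 2 by rewrite -exprD subnK.
by rewrite mulrACA [mp ^+ _ * _]mulrC.
Qed.

(** L^2 is interpolated directly between L^(p_i) and L^4, the latter controlled by [fourth_moment].
    Compared with [truncation_moment], the degrees i = 0 and i = 1 are covered, at the price of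
    bounding the degree of the whole polynomial. *)
Lemma poly_moment (D i : nat) (s : A -> C) :
  (forall a, s a != 0 -> (deg (e a) <= D)%N) ->
  (\sum_a sqm (s a)) ^+ i <=
  4 ^+ D * avg (fun y => sqm (lincomb s (tpt w y)) `^ hexp R i) ^+ i.+1.
Proof.
move=> sD; set m2 := \sum_a sqm (s a); set mp := avg _.
have m20 : 0 <= m2 by apply: sumr_ge0 => a _; exact: sqm_ge0.
have mp0 : 0 <= mp.
  by rewrite divr_ge0 // sumr_ge0 // => y _; exact: powR_ge0.
have [i0|i0] := posnP i.
  (* For i = 0 the exponent [hexp] is 0, and a power with exponent 0 is 1 even at 0, so the average
     is 1. *)
  rewrite i0 expr0 expr1 /mp /avg i0 /hexp mul0r.
  under eq_bigr do rewrite powRr0.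
  rewrite sumr_const card_ffun !card_ord divff ?gt_eqF //.
  by rewrite mulr1 exprn_ege1 // ler1n.
have [m2e|m2n0] := eqVneq m2 0.
  by rewrite m2e expr0n gtn_eqF // mulr_ge0 ?exprn_ge0.
have m2p : 0 < m2 by rewrite lt_neqAle eq_sym m2n0.
pose S (y : Y) := lincomb s (tpt w y).
have i20 : i.+2%:R != 0 :> R by rewrite pnatr_eq0.
have i10 : i.+1%:R != 0 :> R by rewrite pnatr_eq0.
(* The weights solve a + c = 1 and a p_i + 4 c = 2. *)
pose a : R := i.+1%:R / i.+2%:R.
pose c : R := i.+2%:R^-1.
have a0 : 0 < a by rewrite divr_gt0 ?ltr0n.
have c0 : 0 < c by rewrite invr_gt0 ltr0n.
have abc : a + 0 + c = 1 by rewrite /a /c addr0 -[X in _ + X]mul1r -mulrDl natr1 divff.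
have h := @avg_holder3 (fun y => sqm (S y) `^ hexp R i) (fun y => 1)
  (fun y => sqm (S y) ^+ 2) a 0 c (fun=> powR_ge0 _ _) (fun=> ler01)
  (fun=> sqr_ge0 _) a0 (lexx _) c0 abc.
have {}h : m2 <= mp `^ a * (4 ^+ D * m2 ^+ 2) `^ c.
  have m2E : m2 = avg (fun i0 => (sqm (S i0) `^ hexp R i) `^ a * 1 `^ 0 *
        (sqm (S i0) ^+ 2) `^ c).
    have -> : m2 = avg (fun y => sqm (S y)).
      by rewrite /avg /S sum_sqm_lincomb mulrC mulKf // gt_eqF.
    congr (_ / _); apply: eq_bigr => y _.
    rewrite powRr0 mulr1.
    rewrite -powRrM -[sqm (S y) ^+ 2]powR_mulrn ?sqm_ge0 // -[in RHS]powRrM.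
    have E : hexp R i * a + 2 * c = 1.
      rewrite /a /c /hexp -[i.+2%:R]natr1 in i20 *.
      rewrite -[i.+1%:R]natr1 in i10 i20 *; field.
      by rewrite i10 i20.
    by rewrite -powRD ?E ?powRr1 ?sqm_ge0 // oner_eq0.
  rewrite {1}m2E; apply: le_trans h _; rewrite powRr0 mulr1.
  rewrite ler_wpM2l ?mulr_ge0 ?powR_ge0 //.
  apply: ge0_ler_powR; rewrite ?nnegrE.
  - exact: ltW.
  - by rewrite divr_ge0 // sumr_ge0 // => y _; exact: sqr_ge0.
  - by rewrite mulr_ge0 ?exprn_ge0.
  - by rewrite ler_pdivrMr // mulrC; exact: fourth_moment.
clearbody mp m2.
have h2 : m2 ^+ i.+2 <= (mp `^ a * (4 ^+ D * m2 ^+ 2) `^ c) ^+ i.+2.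
  by apply: lerXn2r h; rewrite nnegrE // !mulr_ge0 ?powR_ge0.
have E x q : 0 <= x -> x `^ q ^+ i.+2 = x `^ (q * i.+2%:R) :> R.
  by move=> x0; rewrite -powR_mulrn ?powR_ge0 // -powRrM.
have m4 : 0 <= 4 ^+ D * m2 ^+ 2 by rewrite mulr_ge0 ?exprn_ge0.
move: h2; rewrite !exprMn !E //.
rewrite /a divfK // /c mulVf // powR_mulrn // powRr1 // => h2.
rewrite -(ler_pM2r (exprn_gt0 2 m2p)) -exprD addn2.
by apply: le_trans h2 _; rewrite mulrCA mulrA.
Qed.

End Hyper.

(** * Slices of bounded polynomials *)

Section Averages.
Context {R : realType}.

Lemma jensen_avg (I : finType) (x : I -> R) (e : R) :
  (0 < #|I|)%N -> (forall i, 0 <= x i) -> 0 < e <= 1 ->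
  ((\sum_i x i) / #|I|%:R) `^ e^-1 <= (\sum_i x i `^ e^-1) / #|I|%:R.
Proof.
move=> I0 x0 e01; have M0 : 0 < #|I|%:R :> R by rewrite ltr0n.
rewrite powR_div ?sumr_ge0 ?(ltW M0) // ler_pdivrMr ?powR_gt0 //.
apply: le_trans (powR_sum_le x0 e01) _.
rewrite powRB ?(gt_eqF M0) ?implybT // powRr1 ?(ltW M0) //.
by rewrite mulrAC -mulrA mulrC.
Qed.

Lemma hexp_root (x y : R) i : 0 <= x -> 0 <= y ->
  x ^+ i <= y ^+ i.+1 -> x `^ hexp R i <= y.
Proof.
move=> x0 y0 h.
have -> : x `^ hexp R i = (x ^+ i) `^ (i.+1%:R)^-1.
  by rewrite -powR_mulrn // -powRrM.
have -> : y = (y ^+ i.+1) `^ (i.+1%:R)^-1.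
  by rewrite -powR_mulrn // -powRrM mulfV ?pnatr_eq0 // powRr1.
by apply: ge0_ler_powR; rewrite ?nnegrE ?exprn_ge0 // invr_ge0.
Qed.

Lemma powR_hexpV_le (c : R) j : 1 <= c -> (0 < j)%N ->
  c `^ (hexp R j)^-1 <= c ^+ 2.
Proof.
move=> c1 j0; rewrite -powR_mulrn ?(le_trans _ c1) //; apply: ler_powR => //.
rewrite hexpV // -[2%:R]/(1 + 1) lerD2l invf_le1 ?ltr0n // ler1n //.
Qed.

Lemma powR_hexpV_scale (c x : R) j : 1 <= c -> 0 <= x -> (0 < j)%N ->
  (c * x) `^ (hexp R j)^-1 <= c ^+ 2 * x `^ (hexp R j)^-1.
Proof.
move=> c1 x0 j0; rewrite powRM ?(le_trans _ c1) //.
by rewrite ler_wpM2r ?powR_ge0 // powR_hexpV_le.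
Qed.

(* The number of terms costs only a constant factor, as j^(1/j) <= 2. *)
Lemma powR_sum_hexp (I : finType) (x : I -> R) j : (0 < j)%N ->
  (forall i, 0 <= x i) -> (#|I| <= j)%N ->
  (\sum_i x i) `^ (hexp R j)^-1 <= 2 * \sum_i x i `^ (hexp R j)^-1.
Proof.
move=> j0 x0 Ij; apply: le_trans (powR_sum_le x0 (hexp_itv j0)) _.
apply: ler_wpM2r; first by apply: sumr_ge0 => i _; exact: powR_ge0.
have jp : 0 < j%:R :> R by rewrite ltr0n.
rewrite hexpV // addrC addKr.
apply: (@le_trans _ _ ((2 ^ j)%:R `^ j%:R^-1)).
  apply: ge0_ler_powR; rewrite ?nnegrE ?invr_ge0 ?ler0n //.
  by rewrite ler_nat (leq_trans Ij) // ltnW // ltn_expl.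
by rewrite natrX -powR_mulrn // -powRrM mulfV ?gt_eqF // powRr1.
Qed.

End Averages.

Section Polys.
Context {R : realType}.
Local Notation C := (R[i]).

(** The closed polydisc, unlike the open one in [sup_norm], since it has to contain the grid points
    [tpt w y]; [normc_meval_le] bridges the two. *)
Definition inD n (z : 'I_n -> C) := forall v, normc (z v) <= 1.

Lemma inD_tpt n N (w : C) (y : {ffun 'I_n -> 'I_N}) :
  N.-primitive_root w -> inD (tpt w y).
Proof. by move=> pw v; rewrite tpt_norm. Qed.

Variables (n d : nat).
Local Notation E := {ffun 'I_n -> 'I_d.+1}.

(** Multi-indices with all exponents at most [d] form a finite type; the final bound is independent
    of [d]. *)
Definition ex (a : E) (v : 'I_n) : nat := a v.

Definition poly_bdd (a : E -> C) :=
  forall z, inD z -> normc (lincomb ex a z) <= 1.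

Definition bi_bdd (b : E -> E -> C) := forall x y, inD x -> inD y ->
  normc (\sum_al \sum_be b al be * (mon x (ex al) * mon y (ex be))) <= 1.

Definition hsum (a : E -> C) j : R :=
  \sum_(al | deg (ex al) == j) sqm (a al) `^ hexp R j.

Variables (J W : nat).

(* [hsum a j `^ (hexp R j)^-1] is the square of the l^{p_j} norm of the part of
   degree j. *)
Definition wsum (a : E -> C) : R :=
  \sum_(1 <= j < J) hsum a j `^ (hexp R j)^-1 / j%:R ^+ W.

Lemma hsum_ge0 a j : 0 <= hsum a j.
Proof. by apply: sumr_ge0 => al _; exact: powR_ge0. Qed.

Lemma ex_inj (a b : E) : ex a =1 ex b -> a = b.
Proof. by move=> h; apply/ffunP => v; apply/val_inj/h. Qed.

Lemma wsum_term_le a j : (0 < j < J)%N ->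
  hsum a j `^ (hexp R j)^-1 <= wsum a * j%:R ^+ W.
Proof.
move=> /andP[j0 jJ]; rewrite -ler_pdivrMr ?exprn_gt0 ?ltr0n //.
rewrite /wsum (big_cat_nat (n := j)) //=; last exact: ltnW.
rewrite (big_cat_nat (n := j.+1) (m := j)) //= big_nat1.
rewrite addrCA lerDl addr_ge0 // sumr_ge0 // => i _.
all: by rewrite divr_ge0 ?powR_ge0 ?exprn_ge0.
Qed.

Section Bi.
Variable S : R.
Hypothesis wsum_le : forall a, poly_bdd a -> wsum a <= S.
Variable b : E -> E -> C.
Hypothesis b_bdd : bi_bdd b.

(* Up to the power [(hexp R i)^-1], the square of the norm in l^{p_i}(x; l^2(y)),
   restricted to y-degrees at most [L * i]. *)
Definition xnorm L i : R := \sum_(al | deg (ex al) == i)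
  (\sum_(be | (deg (ex be) <= L * i)%N) sqm (b al be)) `^ hexp R i.

Lemma xnorm_ge0 L i : 0 <= xnorm L i.
Proof. by apply: sumr_ge0 => al _; exact: powR_ge0. Qed.

Lemma slice_bdd y : inD y -> poly_bdd (fun al => lincomb ex (b al) y).
Proof.
move=> yD x xD; apply: le_trans (b_bdd xD yD); rewrite le_eqVlt; apply/orP; left.
apply/eqP; congr normc; apply: eq_bigr => al _.
by rewrite mulr_suml; apply: eq_bigr => be _; rewrite mulrAC mulrA.
Qed.

(** With y-degrees at most L i, the factor 4^(L i) of [truncation_moment] is at most 4^L after an
    (i+1)-th root, and the power [(hexp R i)^-1], at most 2, squares it. The sum starts at 2 because
    [truncation_moment] asks for 1 < i. *)
Lemma mixed_norm_sum_le L :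
  \sum_(2 <= i < J) xnorm L i `^ (hexp R i)^-1 / i%:R ^+ W <=
  (4 ^+ L) ^+ 2 * S.
Proof.
have [w pw] := @prim_root_exists R (d + d).+1 (ltn0Sn _).
set N := (d + d).+1 in pw.
pose Y : finType := {ffun 'I_n -> 'I_N}.
have cardY : #|Y| = (N ^ n)%N by rewrite card_ffun !card_ord.
have Y0 : (0 < #|Y|)%N by rewrite cardY expn_gt0.
have eN (a : E) v : (ex a v + ex a v < N)%N.
  by rewrite ltnS leq_add // -ltnS ltn_ord.
pose sl (y : Y) al := lincomb ex (b al) (tpt w y).
have sl_bdd y : poly_bdd (sl y) by apply: slice_bdd; exact: inD_tpt.
have c1 : 1 <= 4 ^+ L :> R by rewrite exprn_ege1 // ler1n.
apply: (@le_trans _ _ (\sum_(2 <= i < J) (4 ^+ L) ^+ 2 *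
   ((\sum_(y : Y) hsum (sl y) i `^ (hexp R i)^-1) / #|Y|%:R) / i%:R ^+ W)).
  rewrite big_nat_cond [leRHS]big_nat_cond.
  apply: ler_sum => i /andP[/andP[i2 iJ] _].
  have i0 : (0 < i)%N by exact: ltnW.
  rewrite ler_wpM2r ?invr_ge0 ?exprn_ge0 //.
  have h : xnorm L i <= 4 ^+ L * ((\sum_(y : Y) hsum (sl y) i) / #|Y|%:R).
    rewrite exchange_big /= mulr_suml mulr_sumr; apply: ler_sum => al _.
    pose s be := if (deg (ex be) <= L * i)%N then b al be else 0.
    have sE : \sum_(be | (deg (ex be) <= L * i)%N) sqm (b al be) =
        \sum_be sqm (s be).
      rewrite big_mkcond; apply: eq_bigr => be _.
      by rewrite /s; case: ifP; rewrite ?sqm0.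
    have sb be : s be = b al be \/ s be = 0 by rewrite /s; case: ifP; [left|right].
    have sD be : s be != 0 -> (deg (ex be) <= L * i)%N.
      by rewrite /s; case: ifP; rewrite ?eqxx.
    have h := truncation_moment pw ex_inj eN i2 sb sD.
    rewrite sE; apply: hexp_root.
    - by apply: sumr_ge0 => be _; exact: sqm_ge0.
    - rewrite mulr_ge0 ?exprn_ge0 // divr_ge0 // sumr_ge0 // => y _.
      exact: powR_ge0.
    rewrite cardY; apply: le_trans h _; rewrite [leRHS]exprMn.
    apply: ler_wpM2r.
      by rewrite exprn_ge0 // divr_ge0 // sumr_ge0 // => y _; exact: powR_ge0.
    by rewrite exprM exprS ler_peMl // exprn_ge0 // exprn_ge0.
  have avg0 : 0 <= (\sum_(y : Y) hsum (sl y) i) / #|Y|%:R.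
    by rewrite divr_ge0 // sumr_ge0 // => y _; exact: hsum_ge0.
  apply: (@le_trans _ _ ((4 ^+ L *
      ((\sum_(y : Y) hsum (sl y) i) / #|Y|%:R)) `^ (hexp R i)^-1)).
    apply: ge0_ler_powR h; rewrite ?nnegrE ?xnorm_ge0 ?invr_ge0 ?hexp_ge0 //.
    by rewrite mulr_ge0 // exprn_ge0.
  apply: le_trans (powR_hexpV_scale c1 avg0 i0) _.
  rewrite ler_wpM2l ?exprn_ge0 //.
  by apply: jensen_avg => //; [move=> y; exact: hsum_ge0 | exact: hexp_itv].
under eq_bigr do rewrite -mulrA.
rewrite -mulr_sumr ler_wpM2l ?exprn_ge0 //.
under eq_bigr do rewrite -mulrA mulr_suml.
rewrite exchange_big /=.
apply: (@le_trans _ _ (\sum_(y : Y) S / #|Y|%:R)).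
  apply: ler_sum => y _.
  under eq_bigr do rewrite [_^-1 * _]mulrC mulrA.
  rewrite -mulr_suml ler_wpM2r ?invr_ge0 //.
  apply: le_trans (wsum_le (sl_bdd y)); rewrite /wsum.
  have [J2|J2] := leqP J 1%N; first by rewrite !big_geq // ltnW.
  rewrite [leRHS]big_ltn // lerDr.
  by rewrite divr_ge0 ?powR_ge0 ?exprn_ge0.
by rewrite sumr_const -[leLHS]mulr_natr divfK // pnatr_eq0 -lt0n.
Qed.

End Bi.

End Polys.
Arguments ex {n d} a v.

(** * Interpolation between mixed norms and summation over bidegrees *)

Section Interpolation.
Context {R : realType}.

(** Reindexing by l = j - i; as F >= 0, the triangle i + l < J may be enlarged to a square. *)
Lemma sum_antidiag_le (F : nat -> nat -> R) (P : nat -> nat -> bool) J :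
  (forall i l, 0 <= F i l) ->
  \sum_(1 <= j < J) \sum_(i < j | P i (j - i)%N) F i (j - i)%N <=
  \sum_(0 <= i < J) \sum_(0 <= l < J | P i l) F i l.
Proof.
move=> F0.
apply: (@le_trans _ _ (\sum_(0 <= j < J) \sum_(0 <= i < J | (i <= j)%N)
   (if P i (j - i)%N then F i (j - i)%N else 0))).
  case: J => [|J]; first by rewrite !big_geq.
  rewrite [leRHS]big_ltn // -[leLHS]add0r lerD ?sumr_ge0 // => [i _|].
    by case: ifP.
  apply: ler_sum_nat => j /andP[j1 jJ].
  rewrite -(big_mkord (fun i => P i (j - i)%N) (fun i => F i (j - i)%N)).
  rewrite big_mkcond [leRHS](big_cat_nat (n := j)) //=; last exact: ltnW.
  rewrite -[leLHS]addr0 lerD ?sumr_ge0 // => [|i _]; last by case: ifP.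
  rewrite [leRHS]big_nat_cond big_nat_cond le_eqVlt; apply/orP; left.
  by apply/eqP/eq_bigl => i; case: ltnP => //= ij; rewrite ltnW.
rewrite (exchange_big_dep_nat (fun i => true)) //=.
apply: ler_sum => i _.
have <- := @big_nat_widenl _ 0 +%R i 0 J xpredT
  (fun j => if P i (j - i)%N then F i (j - i)%N else 0) (leq0n i).
have -> : i = (0 + i)%N by [].
rewrite big_addn add0n; under eq_bigr do rewrite addnK.
rewrite [leRHS]big_mkcond /= [leRHS](big_cat_nat (n := (J - i)%N)) ?leq_subr //=.
by rewrite lerDl sumr_ge0 // => l _; case: ifP.
Qed.

Lemma hexp_rootV (x y : R) j : (0 < j)%N -> 0 <= x -> 0 <= y ->
  x ^+ j.+1 <= y ^+ j -> x `^ (hexp R j)^-1 <= y.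
Proof.
move=> j0 x0 y0 h.
have -> : x `^ (hexp R j)^-1 = (x ^+ j.+1) `^ (j%:R)^-1.
  by rewrite -powR_mulrn // -powRrM /hexp invf_div.
have -> : y = (y ^+ j) `^ (j%:R)^-1.
  by rewrite -powR_mulrn // -powRrM mulfV ?pnatr_eq0 -?lt0n // powRr1.
by apply: ge0_ler_powR; rewrite ?nnegrE ?exprn_ge0 // invr_ge0.
Qed.

Lemma powR_hexpVX (x : R) i : (0 < i)%N -> 0 <= x ->
  (x `^ (hexp R i)^-1) ^+ i = x ^+ i.+1.
Proof.
move=> i0 x0; rewrite -powR_mulrn ?powR_ge0 // -powRrM /hexp invf_div.
by rewrite divfK ?pnatr_eq0 -?lt0n // powR_mulrn.
Qed.

Lemma mixed_sum_le_cond (U V : finType) (P : pred U) (Q : pred V)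
    (g : U -> V -> R) i l :
  (forall u v, 0 <= g u v) -> (0 < i)%N -> (0 < l)%N ->
  (\sum_(u | P u) \sum_(v | Q v) g u v `^ hexp R (i + l)) ^+ (i + l).+1 <=
  (\sum_(u | P u) (\sum_(v | Q v) g u v) `^ hexp R i) ^+ i.+1 *
  (\sum_(v | Q v) (\sum_(u | P u) g u v) `^ hexp R l) ^+ l.+1.
Proof.
move=> g0 i0 l0; pose h u v := if P u && Q v then g u v else 0.
have h0 u v : 0 <= h u v by rewrite /h; case: ifP.
have e0 k : (0 < k)%N -> 0 `^ hexp R k = 0.
  by move=> k0; rewrite powR0 // gt_eqF // hexp_gt0.
have := @mixed_sum_le R U V h i l h0 i0 l0.
have -> : \sum_u \sum_v h u v `^ hexp R (i + l) =
    \sum_(u | P u) \sum_(v | Q v) g u v `^ hexp R (i + l).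
  rewrite [RHS]big_mkcond; apply: eq_bigr => u _; rewrite /h.
  case: (P u) => /=; last by rewrite big1 // => v _; rewrite e0 // addn_gt0 i0.
  rewrite [RHS]big_mkcond; apply: eq_bigr => v _.
  by case: (Q v); rewrite // e0 // addn_gt0 i0.
have -> : \sum_u (\sum_v h u v) `^ hexp R i =
    \sum_(u | P u) (\sum_(v | Q v) g u v) `^ hexp R i.
  rewrite [RHS]big_mkcond; apply: eq_bigr => u _; rewrite /h.
  by case: (P u) => /=; [rewrite -big_mkcond | rewrite big1 // e0].
have -> // : \sum_v (\sum_u h u v) `^ hexp R l =
    \sum_(v | Q v) (\sum_(u | P u) g u v) `^ hexp R l.
rewrite [RHS]big_mkcond; apply: eq_bigr => v _; rewrite /h.
case: (Q v); last by rewrite big1 ?e0 // => u _; rewrite andbF.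
by under eq_bigr do rewrite andbT; rewrite -big_mkcond.
Qed.

End Interpolation.

Section Balanced.
Context {R : realType}.
Local Notation C := (R[i]).
Variables (n d : nat).
Local Notation E := {ffun 'I_n -> 'I_d.+1}.
Local Notation dg a := (deg (ex a)).

Definition bihsum (b : E -> E -> C) i l : R :=
  \sum_(al | dg al == i) \sum_(be | dg be == l)
    sqm (b al be) `^ hexp R (i + l).

Definition xpart (b : E -> E -> C) i l : R :=
  \sum_(al | dg al == i) (\sum_(be | dg be == l) sqm (b al be)) `^ hexp R i.

Definition swapb (b : E -> E -> C) al be := b be al.

Lemma swap_bdd b : bi_bdd b -> bi_bdd (swapb b).
Proof.
move=> b_bdd x y xD yD; apply: le_trans (b_bdd _ _ yD xD).
rewrite le_eqVlt; apply/orP; left.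
apply/eqP; congr normc; rewrite exchange_big; apply: eq_bigr => al _.
by apply: eq_bigr => be _; rewrite [mon x _ * _]mulrC.
Qed.

Lemma bihsum_ge0 b i l : 0 <= bihsum b i l.
Proof. by do 2![apply: sumr_ge0 => ? _]; exact: powR_ge0. Qed.

Lemma xpart_ge0 b i l : 0 <= xpart b i l.
Proof. by apply: sumr_ge0 => ? _; exact: powR_ge0. Qed.

(** In terms of x and z, the two powers on the right, the interpolation reads T^(j+1) <= x^i z^l
    with j = i + l, and x^i z^l <= (x + z)^j. *)
Lemma bihsum_le b i l : (0 < i)%N -> (0 < l)%N ->
  bihsum b i l `^ (hexp R (i + l))^-1 <=
  xpart b i l `^ (hexp R i)^-1 + xpart (swapb b) l i `^ (hexp R l)^-1.
Proof.
move=> i0 l0; set X := xpart b i l; set Z := xpart (swapb b) l i.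
set x := X `^ _; set z := Z `^ _.
have x0 : 0 <= x by exact: powR_ge0.
have z0 : 0 <= z by exact: powR_ge0.
have il0 : (0 < i + l)%N by rewrite addn_gt0 i0.
apply: (hexp_rootV il0 (bihsum_ge0 b i l) (addr_ge0 x0 z0)).
apply: le_trans (mixed_sum_le_cond _ _ (fun _ _ => sqm_ge0 _) i0 l0) _.
rewrite -/(xpart b i l) -/(xpart (swapb b) l i) -/X -/Z.
rewrite -(powR_hexpVX i0 (xpart_ge0 _ _ _)) -(powR_hexpVX l0 (xpart_ge0 _ _ _)).
rewrite -/x -/z exprD; clearbody x z.
apply: ler_pM; rewrite ?exprn_ge0 //.
  by apply: lerXn2r; rewrite ?nnegrE ?addr_ge0 // lerDl.
by apply: lerXn2r; rewrite ?nnegrE ?addr_ge0 // lerDr.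
Qed.

(** The mechanism that makes the l^2 sum over degrees lossless: since [hexp R i] is at most 1,
    [minkowski_sum] adds up the squared norms of the pieces of bidegree (i, l) over all l at no
    cost. *)
Lemma xpart_sum_le b L i J : (0 < i)%N ->
  \sum_(0 <= l < J | (l <= L * i)%N) xpart b i l `^ (hexp R i)^-1 <=
  xnorm b L i `^ (hexp R i)^-1.
Proof.
move=> i0; have e01 := @hexp_itv R _ i0; have e0 := hexp_gt0 (R := R) i0.
rewrite big_mkord.
pose G (l : 'I_J) al : R := if (dg al == i) && (l <= L * i)%N then
  \sum_(be | dg be == l) sqm (b al be) else 0.
have G0 l al : 0 <= G l al.
  by rewrite /G; case: ifP => // _; apply: sumr_ge0 => be _; exact: sqm_ge0.
have h := @minkowski_sum R _ _ G _ G0 e01.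
have Z0 : 0 <= \sum_l (\sum_al G l al `^ hexp R i) `^ (hexp R i)^-1.
  by apply: sumr_ge0 => l _; exact: powR_ge0.
have -> : \sum_(l < J | (l <= L * i)%N) xpart b i l `^ (hexp R i)^-1 =
    \sum_l (\sum_al G l al `^ hexp R i) `^ (hexp R i)^-1.
  rewrite [LHS]big_mkcond; apply: eq_bigr => l _.
  rewrite /G; case: (leqP l (L * i)%N) => lL.
    congr (_ `^ _); rewrite /xpart big_mkcond; apply: eq_bigr => al _.
    by rewrite andbT; case: ifP => // _; rewrite powR0 // gt_eqF.
  rewrite big1 ?powR0 ?invr_eq0 ?gt_eqF // => al _.
  by rewrite andbF powR0 // gt_eqF.
set Z := \sum_l _ in h Z0 *.
have -> : Z = (Z `^ hexp R i) `^ (hexp R i)^-1.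
  by rewrite -powRrM mulfV ?gt_eqF // powRr1.
have {}h : Z `^ hexp R i <= xnorm b L i.
  apply: le_trans h _; rewrite /xnorm [leRHS]big_mkcond.
  apply: ler_sum => al _; case: ifP => di; last first.
    by rewrite big1 ?powR0 ?gt_eqF // => l _; rewrite /G di.
  apply: ge0_ler_powR; rewrite ?nnegrE ?hexp_ge0 //.
    exact: sumr_ge0.
    by apply: sumr_ge0 => be _; exact: sqm_ge0.
  rewrite /G di /=; under eq_bigr do rewrite big_mkcond /=.
  rewrite -big_mkcond /= exchange_big /= [leRHS]big_mkcond.
  apply: ler_sum => be _; case: ifPn => dL.
    have [dJ|dJ] := ltnP (dg be) J; last first.
      rewrite big1 ?sqm_ge0 // => l _; case: eqP => // dl.
      by move: (ltn_ord l); rewrite -dl ltnNge dJ.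
    rewrite (bigD1 (Ordinal dJ)) //= eqxx big1 ?addr0 // => l.
    move=> /andP[_ /negbTE]; rewrite -val_eqE /= => ld.
    by rewrite eq_sym ld.
  rewrite big1 // => l lL; case: eqP => // dl.
  by move: dL; rewrite dl lL.
by apply: ge0_ler_powR h; rewrite ?nnegrE ?powR_ge0 ?xnorm_ge0 ?invr_ge0 ?hexp_ge0.
Qed.

Variables (J W : nat) (S : R).
Hypothesis wsum_le : forall a : E -> C, poly_bdd a -> wsum J W a <= S.
Variable b : E -> E -> C.
Hypothesis b_bdd : bi_bdd b.

Definition balanced L i l :=
  [&& (1 < i)%N, (1 < l)%N, (l <= L * i)%N & (i <= L * l)%N].

(* If i + l = j with both parts at least j/(L+1), then j^(-W) is smaller than
   both i^(-W) and l^(-W) by the factor (L/(L+1))^W. *)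
Lemma balanced_sum_le L :
  \sum_(1 <= j < J) \sum_(i < j | balanced L i (j - i)%N)
     bihsum b i (j - i)%N `^ (hexp R j)^-1 / j%:R ^+ W <=
  (L%:R / L.+1%:R) ^+ W * (2 * ((4 ^+ L) ^+ 2 * S)).
Proof.
set q : R := L%:R / L.+1%:R.
have q0 : 0 <= q by rewrite divr_ge0.
pose F i l := xpart b i l `^ (hexp R i)^-1 / i%:R ^+ W.
pose G l i := xpart (swapb b) l i `^ (hexp R l)^-1 / l%:R ^+ W.
have F0 i l : 0 <= F i l by rewrite divr_ge0 ?powR_ge0 ?exprn_ge0.
have G0 i l : 0 <= G i l by rewrite divr_ge0 ?powR_ge0 ?exprn_ge0.
have qW i l j : (0 < i)%N -> (i + l = j)%N -> (i <= L * l)%N ->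
    (j%:R ^+ W)^-1 <= q ^+ W * (i%:R ^+ W)^-1 :> R.
  move=> i0 <- il; set k := (i + l)%N.
  have k0 : (0 < k)%N by rewrite /k addn_gt0 i0.
  have ik : (L.+1 * i <= L * k)%N by rewrite mulSn mulnDr addnC leq_add2l.
  rewrite -!exprVn -exprMn.
  apply: lerXn2r; rewrite ?nnegrE ?mulr_ge0 ?invr_ge0 //.
  rewrite /q -mulrA -invfM -div1r ler_pdivrMr ?ltr0n // mulrAC.
  by rewrite ler_pdivlMr ?mulr_gt0 ?ltr0n // mul1r -!natrM ler_nat.
(* For the term F, the condition i <= L l yields the weight gain and l <= L i the degree restriction
   of [xnorm]; for G the two conditions exchange roles. *)
apply: (@le_trans _ _ (\sum_(1 <= j < J) \sum_(i < j | balanced L i (j - i)%N)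
   (q ^+ W * (F i (j - i)%N + G (j - i)%N i)))).
  apply: ler_sum_nat => j /andP[j1 jJ]; apply: ler_sum => i bal.
  have /and4P[i1 l1 li il] := bal.
  have jE : (i + (j - i) = j)%N by rewrite subnKC // ltnW.
  have := bihsum_le b (ltnW i1) (ltnW l1); rewrite jE => h.
  have jW0 : 0 <= (j%:R ^+ W)^-1 :> R by rewrite invr_ge0 exprn_ge0.
  apply: le_trans (ler_wpM2r jW0 h) _.
  rewrite mulrDl mulrDr /F /G; apply: lerD.
    by rewrite mulrCA ler_wpM2l ?powR_ge0 // (qW _ _ _ (ltnW i1) jE).
  by rewrite mulrCA ler_wpM2l ?powR_ge0 // (qW _ i _ (ltnW l1)) // addnC.
under eq_bigr do rewrite -mulr_sumr big_split /=.
rewrite -mulr_sumr ler_wpM2l ?exprn_ge0 // big_split /= mulrDl mul1r.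
have key b' : bi_bdd b' ->
    \sum_(2 <= i < J) \sum_(0 <= l < J | (l <= L * i)%N)
       xpart b' i l `^ (hexp R i)^-1 / i%:R ^+ W <= (4 ^+ L) ^+ 2 * S.
  move=> b'_bdd; apply: le_trans (mixed_norm_sum_le wsum_le b'_bdd L).
  apply: ler_sum_nat => i /andP[i2 _]; rewrite -mulr_suml.
  by rewrite ler_wpM2r ?invr_ge0 ?exprn_ge0 // xpart_sum_le // ltnW.
have from2 (H : nat -> nat -> R) : (forall i l, 0 <= H i l) ->
    \sum_(0 <= i < J) \sum_(0 <= l < J | balanced L i l) H i l <=
    \sum_(2 <= i < J) \sum_(0 <= l < J | (l <= L * i)%N) H i l.
  move=> H0; rewrite big_mkcond /= [leRHS](big_nat_widenl 2 0) //= [leRHS]big_mkcond.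
  apply: ler_sum => i _; case: ifPn => i2; last first.
    by rewrite big1 // => l; rewrite /balanced (negbTE i2).
  rewrite big_mkcond [leRHS]big_mkcond; apply: ler_sum => l _.
  case: ifPn => [/and4P[_ _ -> _] //|_]; by case: ifP.
apply: lerD.
  apply: le_trans (sum_antidiag_le (balanced L) J F0) _.
  exact: le_trans (from2 _ F0) (key _ b_bdd).
apply: le_trans (sum_antidiag_le (balanced L) J (fun i l => G0 l i)) _.
rewrite (exchange_big_dep_nat predT) //=.
have -> : \sum_(0 <= l < J) \sum_(0 <= i < J | balanced L i l) G l i =
    \sum_(0 <= l < J) \sum_(0 <= i < J | balanced L l i) G l i.
  by apply: eq_bigr => l _; apply: eq_bigl => i; rewrite /balanced; lia.
exact: le_trans (from2 _ G0) (key _ (swap_bdd b_bdd)).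
Qed.

End Balanced.

(** * Monomials with small exponents *)

Section CountSplits.
Local Open Scope nat_scope.
Variable n : nat.
Local Notation Sp := {ffun 'I_n -> bool}.

Definition dpart (I : pred 'I_n) (u : 'I_n -> nat) : nat := \sum_(v | I v) u v.

Lemma dpartD (I : pred 'I_n) u : dpart I u + dpart (predC I) u = deg u.
Proof. by rewrite /deg (bigID I). Qed.

(** A random splitting puts v inside and w outside with probability 1/4: the indicator is a product
    over the variables. *)
Lemma card_separating (v w : 'I_n) : v != w ->
  (\sum_(I : Sp) I v * ~~ I w) * 4 = 2 ^ n.
Proof.
move=> vw; pose F x (b : bool) : nat :=
  if x == v then b : nat else if x == w then ~~ b : nat else 1.
have -> : \sum_(I : Sp) I v * ~~ I w = \sum_(I : Sp) \prod_x F x (I x).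
  apply: eq_bigr => I _; rewrite (bigD1 v) //= (bigD1 w) 1?eq_sym //=.
  rewrite big1 /F => [|x /andP[/negbTE -> /negbTE ->]] //.
  by rewrite eqxx eq_sym (negbTE vw) eqxx muln1.
rewrite -bigA_distr_bigA.
have -> : 2 ^ n = \prod_(x : 'I_n) 2 by rewrite prod_nat_const card_ord.
rewrite (bigD1 v) //= (bigD1 w) 1?eq_sym //= [RHS](bigD1 v) //=.
rewrite [in RHS](bigD1 w) 1?eq_sym //= !big_bool /F eqxx.
rewrite [w == v]eq_sym (negbTE vw) eqxx /= !addn0 !mul1n mulnC.
rewrite mulnA; congr (_ * _); apply: eq_bigr => x /andP[/negbTE -> /negbTE ->].
by rewrite big_bool.
Qed.

(** The product of the two parts expands into pairs (v, w); the diagonal never contributes and every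
    other pair has probability 1/4. *)
Lemma sum_split_products (u : 'I_n -> nat) :
  (\sum_(I : Sp) dpart I u * dpart (predC I) u) * 4 + 2 ^ n * \sum_v u v ^ 2 =
  2 ^ n * deg u ^ 2.
Proof.
have -> : \sum_(I : Sp) dpart I u * dpart (predC I) u =
    \sum_v \sum_w u v * u w * \sum_(I : Sp) I v * ~~ I w.
  under [RHS]eq_bigr do under eq_bigr do rewrite big_distrr /=.
  under [RHS]eq_bigr do rewrite exchange_big /=.
  rewrite [RHS]exchange_big /=; apply: eq_bigr => I _.
  rewrite /dpart [\sum_(v | I v) _]big_mkcond [\sum_(v | _) _]big_mkcond /=.
  rewrite big_distrl; apply: eq_bigr => v _; rewrite big_distrr.
  apply: eq_bigr => w _ /=.
  by case: (I v); case: (I w); rewrite /= ?mul0n ?muln0 ?muln1 ?mul1n.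
have D0 (v : 'I_n) : \sum_(I : Sp) I v * ~~ I v = 0.
  by rewrite big1 // => I _; case: (I v).
have -> : deg u ^ 2 = \sum_v \sum_w u v * u w.
  by rewrite -mulnn {1}/deg big_distrl; apply: eq_bigr => v _; rewrite big_distrr.
rewrite big_distrl !big_distrr -big_split; apply: eq_bigr => v _ /=.
rewrite (bigD1 v) //= D0 muln0 add0n [RHS]big_distrr /= [RHS](bigD1 v) //= -mulnn.
rewrite addnC; congr (_ + _); rewrite big_distrl; apply: eq_bigr => w wv /=.
by rewrite -mulnA card_separating 1?eq_sym // mulnC.
Qed.

(** Either one part is at most 1, and j > L + 1 absorbs it, or one part is at most j/(L + 1). *)
Lemma not_balanced_le L i l j : i + l = j -> L.+1 < j ->
  ~~ [&& 1 < i, 1 < l, l <= L * i & i <= L * l] -> L.+1 * (i * l) <= j ^ 2.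
Proof.
move=> <- Lj; rewrite -mulnn => nb.
have key x y : L.+1 < x + y -> (x <= 1) || (L * x < y) ->
    L.+1 * (x * y) <= (x + y) * (x + y).
  move=> Lxy /orP[x1|xy].
    case: x x1 Lxy => [|[|x]] // _ Lxy; first by rewrite mul0n muln0.
    by rewrite mul1n; apply: leq_mul; rewrite ?leq_addl // ltnW.
  rewrite mulnA; apply: leq_mul; last exact: leq_addl.
  by rewrite mulSn leq_add2l ltnW.
have [hx|hx] := boolP ((i <= 1) || (L * i < l)); first exact: key.
have [hy|hy] := boolP ((l <= 1) || (L * l < i)).
  by rewrite (mulnC i) addnC; apply: key => //; rewrite addnC.
move: nb hx hy; rewrite !negb_or -!ltnNge !ltnS.
by move=> /negP nb /andP[h1 h2] /andP[h3 h4]; case: nb; rewrite h1 h2 h3 h4.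
Qed.

(* A second-moment count: on average over the splittings the product of the two
   parts of u is at least (deg u)^2/4 minus a quarter of the sum of squares. *)
Lemma card_balanced_splits (u : 'I_n -> nat) j :
  deg u = j -> 0 < j -> (forall v, 64 * u v < j) ->
  2 ^ n <= 2 * \sum_(I : Sp) balanced 31 (dpart I u) (dpart (predC I) u).
Proof.
move=> uj j0 us.
have j64 : 64 < j.
  have [v uv|u0] := pickP (fun v => 0 < u v).
    by apply: leq_ltn_trans (us v); rewrite leq_pmulr.
  move: j0; rewrite -uj /deg big1 // => v _.
  by move: (u0 v); case: (u v).
have sq : 64 * \sum_v u v ^ 2 <= j ^ 2.
  rewrite -mulnn -{1}uj /deg big_distrl big_distrr; apply: leq_sum => v _ /=.
  by rewrite -mulnn mulnA mulnC; apply: leq_mul => //; exact: ltnW.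
have := sum_split_products u; rewrite uj.
set P := \sum_(I : Sp) _; set Q := \sum_v _ in sq *; set b := \sum_(I : Sp) _ => e.
(* A balanced split has product at most j^2/4, any other at most j^2/32 by [not_balanced_le] with L
   = 31. As the mean is at least j^2/4 - j^2/256, more than half of the splittings are balanced. *)
have h : 32 * P + 0 <= 8 * b * j ^ 2 + 2 ^ n * j ^ 2.
  rewrite addn0 /P /b big_distrr big_distrr big_distrl /=.
  have -> : 2 ^ n * j ^ 2 = \sum_(I : Sp) j ^ 2.
    by rewrite sum_nat_const card_ffun card_bool card_ord.
  rewrite -big_split; apply: leq_sum => I _ /=.
  have ij := dpartD I u; rewrite uj in ij.
  have [_|nb] := boolP (balanced _ _ _).
    rewrite muln1; apply: leq_trans (leq_addr _ _); move: ij.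
    set x := dpart _ _; set y := dpart _ _ => ij; rewrite -ij.
    have [+ _] := nat_AGM2 x y; move: (x * y) (_ ^ 2) => A B; lia.
  rewrite muln0 add0n; apply: (not_balanced_le (L := 31) ij) nb.
    exact: ltn_trans j64.
have j2 : 0 < j ^ 2 by rewrite expn_gt0 j0.
move: e h sq j2; set t := j ^ 2; set M := 2 ^ n => e h sq t0.
suff : t * M <= t * (2 * b) by rewrite leq_pmul2l.
have K : 64 * (M * Q) <= M * t by rewrite mulnCA leq_mul2l sq orbT.
have {}h : 32 * P <= 8 * (b * t) + M * t by rewrite mulnA -[leqLHS]addn0.
rewrite mulnCA (mulnC t M) (mulnC t b).
move: e h K; move: (M * Q) (M * t) (b * t) => x y z; lia.
Qed.

End CountSplits.

(** * Splitting the variables in two groups *)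

Section Splitting.
Context {R : realType}.
Local Notation C := (R[i]).
Variables (n d : nat).
Local Notation E := {ffun 'I_n -> 'I_d.+1}.
Local Notation dg a := (deg (ex a)).

Definition restr (I : pred 'I_n) (al : E) : E :=
  [ffun v => if I v then al v else ord0].

Definition supp_in (I : pred 'I_n) (al : E) :=
  [forall v, I v || (al v == ord0)].

Definition glue (I : pred 'I_n) (al be : E) : E :=
  [ffun v => if I v then al v else be v].

Lemma sum_split (V : nmodType) (I : pred 'I_n) (F : E -> V) :
  \sum_al F al = \sum_al \sum_be
    if supp_in I al && supp_in (predC I) be then F (glue I al be) else 0.
Proof.
rewrite pair_bigA /= -big_mkcond /=.
rewrite (reindex_onto (fun p : E * E => glue I p.1 p.2)
  (fun al => (restr I al, restr (predC I) al))) /=; last first.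
  by move=> al _; apply/ffunP => v; rewrite !ffunE /=; case: (I v).
apply: eq_bigl => -[al be] /=; apply/eqP/andP => [[h1 h2]|[/forallP h1 /forallP h2]].
  rewrite -h1 -h2; split; apply/forallP => v; rewrite !ffunE /=; by case: (I v).
congr pair; apply/ffunP => v; rewrite !ffunE.
  by move: (h1 v); case: (I v) => //= /eqP.
by move: (h2 v) => /=; case: (I v) => //= /eqP.
Qed.

Lemma dpart_glue (I : pred 'I_n) (al be : E) :
  supp_in I al -> supp_in (predC I) be ->
  dpart I (ex (glue I al be)) = dg al /\ dpart (predC I) (ex (glue I al be)) = dg be.
Proof.
move=> /forallP h1 /forallP h2; rewrite /dpart /deg; split.
  rewrite big_mkcond; apply: eq_bigr => v _; rewrite /ex ffunE.
  by move: (h1 v); case: (I v) => //= /eqP ->.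
rewrite big_mkcond; apply: eq_bigr => v _; rewrite /ex ffunE.
by move: (h2 v) => /=; case: (I v) => //= /eqP ->.
Qed.

(** Both groups keep all n variables, with coefficient 0 off the supports, so that one type of
    multi-indices serves every [I]. *)
Definition split_coef (I : pred 'I_n) (a : E -> C) (al be : E) : C :=
  if supp_in I al && supp_in (predC I) be then a (glue I al be) else 0.

Lemma mon_glue (I : pred 'I_n) (al be : E) (x y : 'I_n -> C) :
  supp_in I al -> supp_in (predC I) be ->
  mon (fun v => if I v then x v else y v) (ex (glue I al be)) =
  mon x (ex al) * mon y (ex be).
Proof.
move=> /forallP h1 /forallP h2; rewrite /mon -big_split; apply: eq_bigr => v _.
rewrite /ex ffunE /=; move: (h1 v) (h2 v) => /=.
by case: (I v) => /= [_ /eqP -> | /eqP -> _]; rewrite expr0 ?mulr1 ?mul1r.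
Qed.

Lemma split_eval (I : pred 'I_n) (a : E -> C) (x y : 'I_n -> C) :
  \sum_al \sum_be split_coef I a al be * (mon x (ex al) * mon y (ex be)) =
  lincomb ex a (fun v => if I v then x v else y v).
Proof.
rewrite /lincomb [RHS](sum_split I); apply: eq_bigr => al _; apply: eq_bigr => be _.
by rewrite /split_coef; case: ifP => [/andP[h1 h2]|_]; rewrite ?mul0r ?mon_glue.
Qed.

Lemma split_bdd (I : pred 'I_n) (a : E -> C) : poly_bdd a ->
  bi_bdd (split_coef I a).
Proof.
move=> a_bdd x y xD yD; rewrite split_eval; apply: a_bdd => v.
by case: (I v).
Qed.

Lemma bihsum_split (I : pred 'I_n) (a : E -> C) i l : (0 < i + l)%N ->
  bihsum (split_coef I a) i l =
  \sum_(al | (dpart I (ex al) == i) && (dpart (predC I) (ex al) == l))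
    sqm (a al) `^ hexp R (i + l).
Proof.
move=> il0; rewrite [RHS]big_mkcond [RHS](sum_split I) /bihsum big_mkcond.
apply: eq_bigr => al _; case: ifP => ali.
  rewrite big_mkcond; apply: eq_bigr => be _; rewrite /split_coef.
  case: ifP => bel; case: ifP => [/andP[h1 h2]|_] //.
  - by have [-> ->] := dpart_glue h1 h2; rewrite ali bel.
  - by rewrite sqm0 powR0 // gt_eqF // hexp_gt0.
  - by have [-> ->] := dpart_glue h1 h2; rewrite ali bel.
rewrite big1 // => be _; case: ifP => [/andP[h1 h2]|_] //.
by have [-> ->] := dpart_glue h1 h2; rewrite ali.
Qed.

Definition spread j (al : E) := [forall v, 64 * ex al v < j]%N.

Definition hsum_spread (a : E -> C) j : R :=
  \sum_(al | (dg al == j) && spread j al) sqm (a al) `^ hexp R j.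

Local Notation Sp := {ffun 'I_n -> bool}.

Lemma card_Sp : #|{: Sp}| = (2 ^ n)%N.
Proof. by rewrite card_ffun card_bool card_ord. Qed.

(** By [card_balanced_splits], at least half of the splittings see a given spread monomial in a
    balanced bidegree; hence the factor 2. *)
Lemma hsum_spread_le (a : E -> C) j : (0 < j)%N ->
  hsum_spread a j <= 2 * ((\sum_(I : Sp) \sum_(i < j | balanced 31 i (j - i)%N)
     bihsum (split_coef I a) i (j - i)%N) / #|{: Sp}|%:R).
Proof.
move=> j0; rewrite mulrA ler_pdivlMr ?card_Sp ?ltr0n ?expn_gt0 //.
have -> : \sum_(I : Sp) \sum_(i < j | balanced 31 i (j - i)%N)
     bihsum (split_coef I a) i (j - i)%N =
   \sum_(I : Sp) \sum_al \sum_(i < j | balanced 31 i (j - i)%N)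
     if (dpart I (ex al) == i) && (dpart (predC I) (ex al) == j - i)%N
     then sqm (a al) `^ hexp R j else 0.
  apply: eq_bigr => I _; rewrite [RHS]exchange_big /=; apply: eq_bigr => i _.
  have jE : (i + (j - i) = j)%N by rewrite subnKC // ltnW.
  by rewrite bihsum_split ?jE // big_mkcond.
rewrite exchange_big /= /hsum_spread big_mkcond mulr_suml mulr_sumr.
apply: ler_sum => al _; case: ifPn => [/andP[/eqP dj spr]|_]; last first.
  rewrite mul0r mulr_ge0 //; do 2![apply: sumr_ge0 => ? _].
  by case: ifP => // _; exact: powR_ge0.
have key (I : Sp) : (balanced 31 (dpart I (ex al)) (dpart (predC I) (ex al)))%:R *
    sqm (a al) `^ hexp R j <= \sum_(i < j | balanced 31 i (j - i)%N)
     if (dpart I (ex al) == i) && (dpart (predC I) (ex al) == j - i)%N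
     then sqm (a al) `^ hexp R j else 0.
  have ij := dpartD I (ex al); rewrite dj in ij.
  have [bal|_] := boolP (balanced _ _ _); last first.
    rewrite mul0r; apply: sumr_ge0 => i _.
    by case: ifP => // _; exact: powR_ge0.
  have ltj : (dpart I (ex al) < j)%N.
    by case/and4P: bal => _ l1 _ _; rewrite -ij -addn1 leq_add2l ltnW.
  have lE : (dpart (predC I) (ex al) = j - dpart I (ex al))%N.
    by rewrite -ij addKn.
  rewrite mul1r (bigD1 (Ordinal ltj)) /=; last by rewrite -lE.
  rewrite -lE !eqxx /= lerDl; apply: sumr_ge0 => i _.
  by case: ifP => // _; exact: powR_ge0.
apply: (@le_trans _ _ (2 * \sum_(I : Sp)
   (balanced 31 (dpart I (ex al)) (dpart (predC I) (ex al)))%:R *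
    sqm (a al) `^ hexp R j)); last first.
  by rewrite ler_wpM2l // ler_sum // => I _; exact: key.
rewrite -mulr_suml mulrA mulrC ler_wpM2r ?powR_ge0 // -natr_sum -natrM ler_nat.
by apply: (card_balanced_splits dj j0) => v; exact: (forallP spr v).
Qed.

Variables (J W : nat) (S : R).
Hypothesis wsum_le : forall a : E -> C, poly_bdd a -> wsum J W a <= S.

Lemma spread_sum_le (a : E -> C) : poly_bdd a ->
  \sum_(1 <= j < J) hsum_spread a j `^ (hexp R j)^-1 / j%:R ^+ W <=
  16 * ((31%:R / 32%:R) ^+ W * ((4 ^+ 31) ^+ 2 * S)).
Proof.
move=> a_bdd.
have Sp0 : (0 < #|{: Sp}|)%N by rewrite card_Sp expn_gt0.
pose T I i l := bihsum (split_coef I a) i l.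
have T0 I i l : 0 <= T I i l by exact: bihsum_ge0.
(* Here 8 = 2^2 * 2: the factor of [hsum_spread_le] under a power at most 2, and the sum over i < j
   by [powR_sum_hexp]. The 2 of [balanced_sum_le] makes it 16. *)
apply: (@le_trans _ _ (\sum_(1 <= j < J) 8 * ((\sum_(I : Sp)
    \sum_(i < j | balanced 31 i (j - i)%N)
      T I i (j - i)%N `^ (hexp R j)^-1 / j%:R ^+ W) / #|{: Sp}|%:R))).
  apply: ler_sum_nat => j /andP[j0 _].
  under eq_bigr do rewrite -mulr_suml.
  rewrite -mulr_suml [X in 8 * X]mulrAC mulrA.
  rewrite ler_wpM2r ?invr_ge0 ?exprn_ge0 //.
  have s0 (I : Sp) : 0 <= \sum_(i < j | balanced 31 i (j - i)%N) T I i (j - i)%N.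
    exact: sumr_ge0.
  have avg0 : 0 <= (\sum_(I : Sp) \sum_(i < j | balanced 31 i (j - i)%N)
     T I i (j - i)%N) / #|{: Sp}|%:R by rewrite divr_ge0 // sumr_ge0.
  apply: le_trans (_ : (2 * ((\sum_(I : Sp) \sum_(i < j | balanced 31 i (j - i)%N)
     T I i (j - i)%N) / #|{: Sp}|%:R)) `^ (hexp R j)^-1 <= _).
    apply: ge0_ler_powR (hsum_spread_le a j0); rewrite ?nnegrE ?invr_ge0 ?hexp_ge0 //.
      by apply: sumr_ge0 => al _; exact: powR_ge0.
    exact: mulr_ge0.
  apply: le_trans (powR_hexpV_scale _ avg0 j0) _; first by rewrite ler1n.
  have -> : 8 = 2 ^+ 2 * 2 :> R by rewrite -natrX -natrM.
  rewrite -[leRHS]mulrA ler_wpM2l ?exprn_ge0 //.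
  apply: le_trans (jensen_avg Sp0 s0 (hexp_itv j0)) _.
  rewrite mulrA ler_wpM2r ?invr_ge0 // mulr_sumr; apply: ler_sum => I _.
  rewrite big_mkcond [X in 2 * X]big_mkcond /=.
  have -> : \sum_(i < j) (if balanced 31 i (j - i)%N then
       T I i (j - i)%N `^ (hexp R j)^-1 else 0) =
     \sum_(i < j) (if balanced 31 i (j - i)%N then T I i (j - i)%N else 0)
        `^ (hexp R j)^-1.
    apply: eq_bigr => i _; case: ifP => // _.
    by rewrite powR0 // invr_eq0 gt_eqF // hexp_gt0.
  apply: powR_sum_hexp => //; last by rewrite card_ord.
  by move=> i; case: ifP.
rewrite -mulr_sumr.
have -> : 16 = 8 * 2 :> R by rewrite -natrM.
rewrite -[leRHS]mulrA ler_wpM2l //.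
rewrite -mulr_suml exchange_big /= ler_pdivrMr ?ltr0n //.
rewrite mulr_natr -sumr_const; apply: ler_sum => I _.
rewrite [leRHS]mulrCA.
have h := balanced_sum_le wsum_le (split_bdd I a_bdd) 31.
by apply: le_trans h _.
Qed.

End Splitting.

(** * Monomials with a large exponent *)

Section Pure.
Context {R : realType}.
Local Notation C := (R[i]).
Variables (n d : nat).
Local Notation E := {ffun 'I_n -> 'I_d.+1}.
Local Notation dg a := (deg (ex a)).
Implicit Types (b : E -> E -> C) (al be : E).

Lemma inDM (x y : 'I_n -> C) : inD x -> inD y -> inD (fun v => x v * y v).
Proof. by move=> xD yD v; rewrite normcM mulr_ile1 ?normc_ge0. Qed.

Lemma monM (x y : 'I_n -> C) u :
  mon (fun v => x v * y v) u = mon x u * mon y u.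
Proof. by rewrite /mon -big_split; apply: eq_bigr => v _; rewrite exprMn. Qed.

(** The filtered polynomial is an average of copies of [b] rotated in x, with weights of modulus at
    most 1. The projections below, onto a degree and onto exponents divisible by k, have this
    form. *)
Lemma rot_avg_bdd (T : finType) (lam : T -> C) (r : T -> 'I_n -> C)
    (m : E -> bool) b :
  (0 < #|T|)%N -> (forall t, normc (lam t) <= 1) -> (forall t, inD (r t)) ->
  (forall al, \sum_t lam t * mon (r t) (ex al) = (#|T| * m al)%:R) ->
  bi_bdd b -> bi_bdd (fun al be => if m al then b al be else 0).
Proof.
move=> T0 lam1 rD mE b_bdd x y xD yD.
have T0R : 0 < #|T|%:R :> R by rewrite ltr0n.
rewrite -(ler_pM2l T0R) mulr1 -normc_nat -normcM.
have -> : #|T|%:R * (\sum_al \sum_be (if m al then b al be else 0) *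
      (mon x (ex al) * mon y (ex be))) =
    \sum_t lam t * \sum_al \sum_be b al be *
      (mon (fun v => r t v * x v) (ex al) * mon y (ex be)).
  under [RHS]eq_bigr do rewrite mulr_sumr.
  rewrite [RHS]exchange_big mulr_sumr; apply: eq_bigr => al _.
  under [RHS]eq_bigr do rewrite mulr_sumr.
  rewrite [RHS]exchange_big mulr_sumr; apply: eq_bigr => be _.
  transitivity ((\sum_t lam t * mon (r t) (ex al)) *
     (b al be * (mon x (ex al) * mon y (ex be)))); last first.
    rewrite mulr_suml; apply: eq_bigr => t _; rewrite monM; ring.
  by rewrite mE; case: (m al); rewrite ?muln1 ?muln0 ?mul0r ?mulr0.
apply: le_trans (normc_sum _ _ _) _; rewrite normc_nat.
rewrite -sum1_card natr_sum; apply: ler_sum => t _.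
rewrite normcM mulr_ile1 ?normc_ge0 //; apply: b_bdd => //.
exact: inDM.
Qed.

Lemma eq_bi_bdd b b' : b =2 b' -> bi_bdd b -> bi_bdd b'.
Proof.
move=> bb' h x y xD yD; have := h x y xD yD.
by under eq_bigr do under eq_bigr do rewrite bb'.
Qed.

Lemma deg_le al : (dg al <= n * d)%N.
Proof.
apply: (@leq_trans (\sum_(v < n) d)%N); last by rewrite sum_nat_const card_ord.
by apply: leq_sum => v _; rewrite -ltnS ltn_ord.
Qed.

Lemma mon_const (z : C) u : mon (fun _ : 'I_n => z) u = z ^+ deg u.
Proof. by rewrite /mon prodrXr. Qed.

Lemma degree_bdd b k : bi_bdd b ->
  bi_bdd (fun al be => if dg al == k then b al be else 0).
Proof.
(* N exceeds k and every degree, so that congruence modulo N is equality. *)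
move=> b_bdd; pose N := (n * d + k).+1.
have [w pw] := @prim_root_exists R N (ltn0Sn _).
have w1 (t : 'I_N) : normc (w ^+ t) = 1.
  apply: (normc_root_unity (ltn0Sn (n * d + k))).
  by rewrite exprAC (prim_expr_order pw) expr1n.
apply: (@rot_avg_bdd 'I_N (fun t => ((w ^+ t) ^+ k)^*) (fun t _ => w ^+ t)) => //.
- by rewrite card_ord.
- by move=> t; rewrite normc_conj normcX w1 expr1n.
- by move=> t v; rewrite w1.
move=> al; under eq_bigr do rewrite mon_const mulrC.
rewrite (sum_root_unity _ _ pw) card_ord !modn_small //.
  by rewrite ltnS leq_addl.
by rewrite ltnS (leq_trans (deg_le al)) // leq_addr.
Qed.

Definition kpow (k : nat) (v : 'I_n) : E :=
  [ffun u => if u == v then inord k else ord0].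

(** Divisibility is what an average over k-th roots of unity detects; for 0 < k <= d, [sum_pure]
    identifies these multi-indices with the pure powers [kpow k v]. *)
Definition pure k al := (dg al == k) && [forall v, (k %| ex al v)%N].

(* Averaging over k-th roots of unity in each variable kills every monomial of
   degree k other than the pure powers. *)
Lemma pure_bdd b k : (0 < k)%N -> bi_bdd b ->
  bi_bdd (fun al be => if pure k al then b al be else 0).
Proof.
move=> k0 /(@degree_bdd _ k) b_bdd.
have [w pw] := @prim_root_exists R k k0.
have T0 : (0 < #|{: {ffun 'I_n -> 'I_k}}|)%N.
  by rewrite card_ffun !card_ord expn_gt0 k0.
pose m al := [forall v, (k %| ex al v)%N].
have /(_ m T0) h := @rot_avg_bdd {ffun 'I_n -> 'I_k} (fun=> 1) (tpt w) _ _ _ _ _ _ b_bdd.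
apply: (@eq_bi_bdd (fun al be =>
    if m al then (if dg al == k then b al be else 0) else 0)) => [al be|].
  by rewrite /pure -/(m al); case: eqP; case: (m al).
apply: h => [t|t|al]; first by rewrite normc1.
  exact: inD_tpt pw.
under eq_bigr do rewrite mul1r.
rewrite /mon (sum_torus_prod _ _ (fun v z => z ^+ ex al v)).
have E v : \sum_(t < k) (w ^+ t) ^+ ex al v = (k * (k %| ex al v)%N)%:R.
  have -> : (k %| ex al v)%N = (ex al v == 0 %[mod k])%N by rewrite mod0n.
  rewrite -(sum_root_unity _ _ pw); apply: eq_bigr => t _.
  by rewrite expr0 rmorph1 mulr1.
under eq_bigr do rewrite E natrM.
rewrite big_split /= prodr_const card_ffun !card_ord natrM natrX; congr (_ * _).
rewrite /m; case: forallP => [h'|/forallP]; first by rewrite big1 // => v _; rewrite h'.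
by rewrite negb_forall => /existsP[v /negbTE h']; rewrite (bigD1 v) //= h' mul0r.
Qed.

Lemma ex_kpow k v u : (k <= d)%N -> ex (kpow k v) u = if u == v then k else 0%N.
Proof.
by move=> kd; rewrite /ex ffunE; case: eqP => // _; rewrite inordK.
Qed.

Lemma mon_kpow k v (x : 'I_n -> C) : (k <= d)%N -> mon x (ex (kpow k v)) = x v ^+ k.
Proof.
move=> kd; rewrite /mon (bigD1 v) //= ex_kpow // eqxx big1 ?mulr1 // => u /negbTE uv.
by rewrite ex_kpow // uv expr0.
Qed.

Lemma sum_pure (V : nmodType) k (F : E -> V) : (0 < k <= d)%N ->
  \sum_(al | pure k al) F al = \sum_v F (kpow k v).
Proof.
move=> /andP[k0 kd].
have inj : injective (kpow k).
  move=> v u /(congr1 (fun f => ex f v)); rewrite !ex_kpow // eqxx.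
  by case: eqP => // _ k00; move: k0; rewrite k00.
transitivity (\sum_(al in [set kpow k v | v in [set: 'I_n]]) F al); last first.
  by rewrite big_imset => [|? ? _ _ /inj //]; apply: eq_bigl => v; rewrite inE.
apply: eq_bigl => al; apply/andP/imsetP => [[/eqP dk /forallP kal]|[v _ ->]].
  have [v v0|u0] := pickP (fun v => 0 < ex al v)%N; last first.
    move: k0; rewrite -dk /deg big1 // => v _.
    by move: (u0 v); case: (ex al v).
  have kv : (k <= ex al v)%N by apply: dvdn_leq.
  exists v => //; apply: ex_inj => u; rewrite ex_kpow //.
  move: dk; rewrite /deg (bigD1 v) //= => dk.
  have [->|uv] := eqVneq u v; first by move: kv dk; lia.
  by move: dk; rewrite (bigD1 u) //=; move: kv; lia.
split; last by apply/forallP => u; rewrite ex_kpow //; case: eqP.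
rewrite /deg (bigD1 v) //= big1 ?ex_kpow // ?eqxx ?addn0 // => u /negbTE uv.
by rewrite ex_kpow // uv.
Qed.

Definition pure_coef b k l (v : 'I_n) be : C :=
  if dg be == l then b (kpow k v) be else 0.

(* Replacing x_v by a k-th root of X_v makes the pure part linear in X. *)
Lemma pure_coef_bdd b k l (X y : 'I_n -> C) : (0 < k <= d)%N -> bi_bdd b ->
  inD X -> inD y ->
  normc (\sum_v X v * lincomb ex (pure_coef b k l v) y) <= 1.
Proof.
move=> k0d b_bdd XD yD; have /andP[k0 kd] := k0d.
have b1 := swap_bdd (degree_bdd l (swap_bdd (pure_bdd k0 b_bdd))).
pose x v := k.-root (X v).
have xk v : x v ^+ k = X v by rewrite rootCK.
have xD : inD x.
  move=> v; have := XD v; rewrite -(xk v) normcX.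
  by rewrite expr_le1 ?normc_ge0.
apply: le_trans (b1 x y xD yD); rewrite le_eqVlt; apply/orP; left; apply/eqP.
congr normc.
transitivity (\sum_(al | pure k al) \sum_be
   (if dg be == l then b al be else 0) * (mon x (ex al) * mon y (ex be))).
  rewrite (sum_pure _ k0d); apply: eq_bigr => v _; rewrite mulr_sumr.
  by apply: eq_bigr => be _; rewrite mon_kpow // xk /pure_coef mulrCA.
rewrite big_mkcond; apply: eq_bigr => al _; rewrite /swapb.
case: ifP => pal; first by apply: eq_bigr => be _.
by rewrite big1 // => be _; case: ifP; rewrite mul0r.
Qed.

(** The linear form of [pure_coef_bdd] is tested at the conjugate phases of its coefficients. *)
Lemma pure_coef_l1 b k l (y : 'I_n -> C) : (0 < k <= d)%N -> bi_bdd b ->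
  inD y -> \sum_v normc (lincomb ex (pure_coef b k l v) y) <= 1.
Proof.
move=> k0d b_bdd yD; pose c v := lincomb ex (pure_coef b k l v) y.
pose X v := if c v == 0 then 0 else (c v)^* / (normc (c v))%:C%C.
have XD : inD X.
  move=> v; rewrite /X; case: eqP => [_|/eqP c0]; first by rewrite normc0.
  rewrite normcM normc_conj normcV normc_real ?normc_ge0 // divff //.
  by apply: contra c0 => /eqP/eq0_normc/eqP.
have XE v : X v * c v = (normc (c v))%:C%C.
  rewrite /X; have [->|c0] := eqVneq (c v) 0; first by rewrite mulr0 normc0.
  rewrite mulrAC [_^* * _]mulrC -sqmE /sqm rmorphXn /= expr2 mulfK //.
  rewrite (_ : 0 = 0%:C%C) // (inj_eq (@complexI R)).
  by apply: contra c0 => /eqP/eq0_normc/eqP.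
apply: le_trans (pure_coef_bdd l k0d b_bdd XD yD).
under [X in normc X]eq_bigr do rewrite XE.
by rewrite -rmorph_sum normc_real // sumr_ge0 // => v _; exact: normc_ge0.
Qed.

(** As p_k = 2 hexp k is at least 1 and each modulus is at most 1, its p_k-th power is at most the
    modulus. *)
Lemma sum_powR_le1 (I : finType) (c : I -> C) k : (0 < k)%N ->
  \sum_v normc (c v) <= 1 -> \sum_v sqm (c v) `^ hexp R k <= 1.
Proof.
move=> k0 c1; apply: (le_trans _ c1); apply: ler_sum => v _.
have cv1 : normc (c v) <= 1.
  apply: le_trans c1; rewrite (bigD1 v) //= lerDl sumr_ge0 // => u _.
  exact: normc_ge0.
have e1 : 1 <= 2 * hexp R k.
  rewrite /hexp mulrA ler_pdivlMr ?ltr0n // mul1r -natrM ler_nat; lia.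
have [->|c0] := eqVneq (c v) 0.
  by rewrite sqm0 normc0 powR0 // gt_eqF // hexp_gt0.
rewrite sqm_powR; apply: ge1r_powR => //; rewrite cv1 andbT.
rewrite lt_neqAle normc_ge0 andbT eq_sym.
by apply: contra c0 => /eqP/eq0_normc/eqP.
Qed.

End Pure.

Section PureEstimate.
Context {R : realType}.
Local Notation C := (R[i]).
Variables (n d : nat).
Local Notation E := {ffun 'I_n -> 'I_d.+1}.
Local Notation dg a := (deg (ex a)).
Variables (b : E -> E -> C) (k l : nat).
Hypothesis k0d : (0 < k <= d)%N.
Hypothesis b_bdd : bi_bdd b.

Local Notation c := (pure_coef b k l).

Lemma exprn_root_mul (x y : R) (j : nat) : 0 <= x -> 0 <= y ->
  (x `^ j.+1%:R^-1 * y) ^+ j.+1 = x * y ^+ j.+1.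
Proof.
move=> x0 y0; rewrite exprMn -[(x `^ _) ^+ _]powR_mulrn ?powR_ge0 // -powRrM.
by rewrite mulVf ?pnatr_eq0 // powRr1.
Qed.

(** The l^1 bound on pure powers takes the place of the hypothesis on [wsum], so S does not appear.
    This is why [pure_hsum_le] contains only S^l. *)
Lemma pure_x_le :
  (\sum_v (\sum_be sqm (c v be)) `^ hexp R k) ^+ k.+1 <= 4 ^+ l.
Proof.
have /andP[k0 kd] := k0d.
have [w pw] := @prim_root_exists R (d + d).+1 (ltn0Sn _).
set N := (d + d).+1 in pw.
pose Y : finType := {ffun 'I_n -> 'I_N}.
have cardY : #|Y| = (N ^ n)%N by rewrite card_ffun !card_ord.
have Nn : 0 < (N ^ n)%:R :> R by rewrite ltr0n expn_gt0.
have eN (al : E) v : (ex al v + ex al v < N)%N.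
  by rewrite ltnS leq_add // -ltnS ltn_ord.
pose f v (y : Y) := sqm (lincomb ex (c v) (tpt w y)) `^ hexp R k.
pose c4 : R := (4 ^+ l) `^ k.+1%:R^-1.
have c40 : 0 <= c4 by exact: powR_ge0.
have f0 v : 0 <= (\sum_y f v y) / (N ^ n)%:R.
  by rewrite divr_ge0 // sumr_ge0 // => y _; exact: powR_ge0.
have h : \sum_v (\sum_be sqm (c v be)) `^ hexp R k <= c4.
  apply: (@le_trans _ _ (\sum_v c4 * ((\sum_y f v y) / (N ^ n)%:R))).
    apply: ler_sum => v _; apply: hexp_root.
    - by apply: sumr_ge0 => be _; exact: sqm_ge0.
    - exact: mulr_ge0.
    rewrite exprn_root_mul ?exprn_ge0 //.
    apply: (poly_moment pw (@ex_inj n d) eN) => be.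
    by rewrite /pure_coef; case: (dg be =P l) => [-> //|_]; rewrite eqxx.
  rewrite -mulr_sumr -mulr_suml exchange_big /= ler_piMr //.
  rewrite ler_pdivrMr // mul1r -cardY -sum1_card natr_sum.
  apply: ler_sum => y _; apply: sum_powR_le1 => //.
  by apply: pure_coef_l1 => //; exact: inD_tpt pw.
have x0 : 0 <= \sum_v (\sum_be sqm (c v be)) `^ hexp R k.
  by apply: sumr_ge0 => v _; exact: powR_ge0.
have := @lerXn2r _ k.+1 _ _ _ _ h; rewrite !nnegrE => /(_ x0 c40).
by rewrite -(mulr1 c4) exprn_root_mul ?exprn_ge0 // expr1n mulr1.
Qed.

Definition delta (v u : 'I_n) : nat := u == v.

Lemma mon_delta (x : 'I_n -> C) v : mon x (delta v) = x v.
Proof.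
rewrite /mon (bigD1 v) //= /delta eqxx expr1 big1 ?mulr1 // => u /negbTE uv.
by rewrite uv expr0.
Qed.

Variables (J W : nat) (S : R).
Hypothesis wsum_le : forall a : E -> C, poly_bdd a -> wsum J W a <= S.
Hypothesis S0 : 0 <= S.

(** For fixed x the slice in y is bounded, so S controls its part of degree l; passing to l^2 over v
    concerns linear forms and costs one factor 4. *)
Lemma pure_y_le : (0 < l < J)%N ->
  (\sum_be (\sum_v sqm (c v be)) `^ hexp R l) ^+ l.+1 <=
  4 * (S * l%:R ^+ W) ^+ l.
Proof.
move=> l0J; have /andP[l0 lJ] := l0J.
(* Cube roots of unity suffice for linear forms: doubled exponents are at most 2. *)
have [w pw] := @prim_root_exists R 3 (ltn0Sn _).
pose X : finType := {ffun 'I_n -> 'I_3}.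
have cardX : #|X| = (3 ^ n)%N by rewrite card_ffun !card_ord.
have Nn : 0 < (3 ^ n)%:R :> R by rewrite ltr0n expn_gt0.
have eN (v u : 'I_n) : (delta v u + delta v u < 3)%N by rewrite /delta; case: eqP.
have inj (v u : 'I_n) : delta v =1 delta u -> v = u.
  by move=> /(_ v); rewrite /delta eqxx; case: eqP.
pose f be (x : X) := sqm (lincomb delta (c^~ be) (tpt w x)) `^ hexp R l.
pose c4 : R := 4 `^ l.+1%:R^-1.
pose h0 : R := (S * l%:R ^+ W) `^ hexp R l.
have SW0 : 0 <= S * l%:R ^+ W by rewrite mulr_ge0 ?exprn_ge0.
have c40 : 0 <= c4 by exact: powR_ge0.
have h00 : 0 <= h0 by exact: powR_ge0.
have f0 be : 0 <= (\sum_x f be x) / (3 ^ n)%:R.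
  by rewrite divr_ge0 // sumr_ge0 // => y _; exact: powR_ge0.
have slice x : inD x -> poly_bdd (fun be => lincomb delta (c^~ be) x).
  move=> xD y yD; apply: le_trans (pure_coef_bdd l k0d b_bdd xD yD).
  rewrite le_eqVlt; apply/orP; left; apply/eqP; congr normc.
  under [RHS]eq_bigr do rewrite mulr_sumr.
  rewrite [RHS]exchange_big; apply: eq_bigr => be _.
  by rewrite mulr_suml; apply: eq_bigr => v _; rewrite mon_delta mulrA [x v * _]mulrC.
have hs x : inD x ->
    \sum_be sqm (lincomb delta (c^~ be) x) `^ hexp R l <= h0.
  move=> xD; have := wsum_term_le W (fun be => lincomb delta (c^~ be) x) l0J.
  set H := hsum _ l => hH.
  have -> : \sum_be sqm (lincomb delta (c^~ be) x) `^ hexp R l = H.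
    rewrite /H /hsum [RHS]big_mkcond; apply: eq_bigr => be _.
    case: ifPn => // bel; rewrite /lincomb big1 ?sqm0 ?powR0 //.
      by rewrite gt_eqF // hexp_gt0.
    by move=> v _; rewrite /pure_coef (negbTE bel) mul0r.
  have H0 : 0 <= H by exact: hsum_ge0.
  have -> : H = (H `^ (hexp R l)^-1) `^ hexp R l.
    by rewrite -powRrM mulVf ?powRr1 // gt_eqF // hexp_gt0.
  apply: ge0_ler_powR; rewrite ?nnegrE ?powR_ge0 ?hexp_ge0 //.
  apply: le_trans hH _; rewrite ler_wpM2r ?exprn_ge0 //.
  exact/wsum_le/slice.
have h : \sum_be (\sum_v sqm (c v be)) `^ hexp R l <= c4 * h0.
  apply: (@le_trans _ _ (\sum_be c4 * ((\sum_x f be x) / (3 ^ n)%:R))).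
    apply: ler_sum => be _; apply: hexp_root.
    - by apply: sumr_ge0 => v _; exact: sqm_ge0.
    - exact: mulr_ge0.
    rewrite exprn_root_mul //.
    have := @poly_moment R n 3 w pw _ delta inj eN 1 l (c^~ be).
    rewrite expr1; apply => v _.
    by rewrite /deg (bigD1 v) //= /delta eqxx big1 // => u /negbTE ->.
  rewrite -mulr_sumr -mulr_suml exchange_big /= ler_wpM2l //.
  rewrite ler_pdivrMr // -cardX mulr_natr -sumr_const.
  by apply: ler_sum => x _; apply: hs; exact: inD_tpt pw.
have x0 : 0 <= \sum_be (\sum_v sqm (c v be)) `^ hexp R l.
  by apply: sumr_ge0 => v _; exact: powR_ge0.
have := @lerXn2r _ l.+1 _ _ _ _ h; rewrite !nnegrE mulr_ge0 //.
move=> /(_ x0 isT) /le_trans; apply.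
rewrite exprn_root_mul // /h0 -[_ ^+ l.+1]powR_mulrn ?powR_ge0 // -powRrM.
by rewrite /hexp divfK ?pnatr_eq0 // powR_mulrn.
Qed.

Lemma pure_hsum_le : (l < J)%N ->
  (\sum_v \sum_be sqm (c v be) `^ hexp R (k + l)) ^+ (k + l).+1 <=
  4 ^+ (k + l) * (S * l%:R ^+ W) ^+ l.
Proof.
move=> lJ; have /andP[k0 kd] := k0d.
(* [mixed_sum_le] asks for l > 0. For l = 0 only the zero multi-index in y contributes, and
   [pure_x_le] is enough. *)
have [l0|l0] := posnP l.
  have -> : (k + l = k)%N by rewrite l0 addn0.
  have -> : (S * l%:R ^+ W) ^+ l = 1 by rewrite l0 expr0.
  rewrite mulr1; apply: le_trans (_ : 4 ^+ l <= _); last first.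
    by rewrite l0 expr0 exprn_ege1 // ler1n.
  apply: le_trans pure_x_le.
  apply: lerXn2r; rewrite ?nnegrE.
  - by do 2![apply: sumr_ge0 => ? _]; exact: powR_ge0.
  - by apply: sumr_ge0 => ? _; exact: powR_ge0.
  have k00 : hexp R k != 0 by rewrite gt_eqF // hexp_gt0.
  apply: ler_sum => v _; pose z : E := [ffun=> ord0].
  have cz be : be != z -> c v be = 0.
    move=> bez; rewrite /pure_coef l0 /deg sum_nat_eq0.
    case: forallP => // be0; case/negP: bez; apply/eqP/ffunP => u.
    by rewrite ffunE; apply/val_inj; have := be0 u; move=> /eqP.
  rewrite [leLHS](bigD1 z) //= [X in _ <= X `^ _](bigD1 z) //=.
  rewrite big1 => [|be /cz ->]; last by rewrite sqm0 powR0.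
  by rewrite big1 => [|be /cz ->]; rewrite ?addr0 ?sqm0.
apply: le_trans (mixed_sum_le (fun v be => sqm_ge0 (c v be)) k0 l0) _.
have l0J : (0 < l < J)%N by rewrite l0.
have p0 (T : finType) (g : T -> R) e : 0 <= (\sum_t g t `^ hexp R e) ^+ e.+1.
  by rewrite exprn_ge0 // sumr_ge0 // => t _; exact: powR_ge0.
apply: le_trans (ler_pM (p0 _ _ _) (p0 _ _ _) pure_x_le (pure_y_le l0J)) _.
rewrite mulrA ler_wpM2r ?exprn_ge0 ?mulr_ge0 ?exprn_ge0 //.
by rewrite -exprSr ler_weXn2l ?ler1n // -addn1 addnC leq_add2r.
Qed.

End PureEstimate.

(** * Isolating a variable by random colourings *)

Section CountColorings.
Local Open Scope nat_scope.

(** Bernoulli's inequality prod (1 - p_u/M) >= 1 - sum p_u/M, cleared of denominators; truncated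
    subtraction makes the left side 0 when the sum exceeds M. *)
Lemma bernoulli_prod (T : Type) (r : seq T) (p : T -> bool) (M : nat) :
  (M - \sum_(u <- r) p u) * \prod_(u <- r) M <= M * \prod_(u <- r) (M - p u).
Proof.
elim: r => [|x r IH]; first by rewrite !big_nil subn0.
rewrite !big_cons; move: IH; set s := \sum_(u <- r) _; set P := \prod_(u <- r) M.
set Q := \prod_(u <- r) _; case: (p x) => IH; last first.
  by rewrite add0n subn0 mulnCA leq_mul2l IH orbT.
have [Ms|sM] := leqP M s; first by rewrite (_ : M - (true + s) = 0) //; lia.
rewrite mulnCA [X in _ <= X]mulnCA.
apply: (@leq_trans ((M - 1) * ((M - s) * P))); last by rewrite leq_mul2l IH orbT.
rewrite !mulnA leq_mul2r; apply/orP; right.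
have -> : M - (true + s) = M - s - 1 by lia.
move: (M - s) (leq_subr s M) => t tM; nia.
Qed.

Definition color0 n l (c : {ffun 'I_n -> 'I_(2 * l).+1}) : pred 'I_n :=
  [pred v | c v == ord0].

Definition isolates n l (c : {ffun 'I_n -> 'I_(2 * l).+1}) (v : 'I_n)
    (u : 'I_n -> nat) : bool :=
  color0 c v && [forall w, (w != v) ==> (u w != 0) ==> ~~ color0 c w].

(** With M = 2 l + 1 colours, v gets colour 0 with probability 1/M, and the other variables of u, at
    most l in number, avoid it with probability at least 1 - l/M >= 1/2. A uniform splitting in two
    could isolate v with probability only 2^(-l-1). *)
Lemma card_isolating n l (v : 'I_n) (u : 'I_n -> nat) : deg u = u v + l ->
  (2 * l).+1 ^ n <=
  2 * (2 * l).+1 * \sum_(c : {ffun 'I_n -> 'I_(2 * l).+1}) isolates c v u.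
Proof.
set M := (2 * l).+1 => du.
pose F w (t : 'I_M) : nat :=
  if w == v then t == ord0 : nat else if u w == 0 then 1 else t != ord0 : nat.
have -> : \sum_(c : {ffun 'I_n -> 'I_M}) isolates c v u =
    \sum_(c : {ffun 'I_n -> 'I_M}) \prod_w F w (c w).
  apply: eq_bigr => c _; rewrite (bigD1 v) //= /F eqxx /isolates /color0 /=.
  case: (c v == ord0); rewrite ?mul0n ?mul1n //=.
  case: forallP => [h|/forallP].
    rewrite big1 // => w wv; have := h w; rewrite wv (negbTE wv) /=.
    by case: (u w == 0) => //= ->.
  rewrite negb_forall => /existsP[w]; rewrite 2!negb_imply.
  move=> /and3P[wv uw /negPn cw].
  by rewrite (bigD1 w) //= (negbTE wv) (negbTE uw) cw mul0n.
rewrite -bigA_distr_bigA /=.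
have c0 : \sum_(t < M) (t == ord0 :> 'I_M) = 1.
  by rewrite (bigD1 ord0) //= big1 // => t /negbTE ->.
have c1 : \sum_(t < M) (t != ord0 :> 'I_M) = M - 1.
  have : \sum_(t < M) (t == ord0 :> 'I_M) + \sum_(t < M) (t != ord0 :> 'I_M) = M.
    rewrite -big_split; transitivity (\sum_(t < M) 1).
      by apply: eq_bigr => t _ /=; case: (t == ord0).
    by rewrite sum_nat_const card_ord muln1.
  by rewrite c0; move: (\sum_(t < M) _) => q; lia.
have -> : \prod_w \sum_(t < M) F w t = \prod_(w | w != v) (M - (u w != 0)).
  rewrite (bigD1 v) //= {1}/F eqxx c0 mul1n; apply: eq_bigr => w wv.
  rewrite /F (negbTE wv); case: (u w == 0); last exact: c1.
  by rewrite sum_nat_const card_ord muln1 subn0.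
have -> : M ^ n = \prod_(w < n) M by rewrite prod_nat_const card_ord.
rewrite (bigD1 v) //= -big_filter.
rewrite -[X in _ <= _ * X]big_filter.
set r := seq.filter _ _; have := bernoulli_prod r (fun w => u w != 0) M.
set P := \prod_(w <- r) M; set Q := \prod_(w <- r) _; set s := \sum_(w <- r) _.
have sl : s <= l.
  move: du; rewrite /deg (bigD1 v) //= => /addnI <-.
  rewrite /s big_filter; apply: leq_sum => w _; by case: (u w).
move=> h; rewrite -mulnA; apply: (@leq_trans (2 * ((M - s) * P))); last first.
  by rewrite leq_mul2l h.
by rewrite mulnA leq_mul2r; apply/orP; right; rewrite /M; lia.
Qed.

End CountColorings.

Section Dominated.
Context {R : realType}.
Local Notation C := (R[i]).
Variables (n d : nat).
Local Notation E := {ffun 'I_n -> 'I_d.+1}.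
Local Notation dg a := (deg (ex a)).
Variable (a : E -> C).

Definition dom_sum j k : R := \sum_v \sum_(al | (dg al == j) && (ex al v == k))
  sqm (a al) `^ hexp R j.

Lemma dom_sum_ge0 j k : 0 <= dom_sum j k.
Proof. by do 2![apply: sumr_ge0 => ? _]; exact: powR_ge0. Qed.

(** If [c] isolates [v], the part of the monomial in colour 0 is exactly x_v^k, so the multi-index
    is glued from [kpow d k v] and some [be] of degree l. *)
Lemma isolated_le k l (c : {ffun 'I_n -> 'I_(2 * l).+1}) (v : 'I_n) :
  (0 < k <= d)%N ->
  \sum_(al | (dg al == k + l)%N && (ex al v == k))
     (isolates c v (ex al))%:R * sqm (a al) `^ hexp R (k + l) <=
  \sum_be sqm (pure_coef (split_coef (color0 c) a) k l v be) `^ hexp R (k + l).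
Proof.
move=> /andP[k0 kd]; set I := color0 c.
rewrite big_mkcond (sum_split I) exchange_big; apply: ler_sum => be _ /=.
rewrite (bigD1 (kpow d k v)) //= [X in _ + X]big1 ?addr0.
  case: ifPn => [/andP[h1 h2]|_]; last exact: powR_ge0.
  case: ifPn => [/andP[/eqP dj vk]|_]; last exact: powR_ge0.
  case: (isolates _ _ _); last by rewrite mul0r powR_ge0.
  rewrite mul1r /pure_coef /split_coef h1 h2.
  have [hi he] := dpart_glue h1 h2.
  have dk : dg (kpow d k v) = k.
    rewrite /deg (bigD1 v) //= ex_kpow // eqxx big1 ?addn0 // => u /negbTE uv.
    by rewrite ex_kpow // uv.
  have -> : dg be == l.
    have := dpartD I (ex (glue I (kpow d k v) be)).
    by rewrite hi he dj dk => /addnI ->.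
  by [].
move=> al alk; case: ifPn => // /andP[h1 h2]; case: ifPn => // /andP[_ vk].
have [/andP[cv /forallP iso]|_] := boolP (isolates _ _ _); last by rewrite mul0r.
case/negP: alk; apply/eqP/ex_inj => u; rewrite ex_kpow //.
have gI w : I w -> ex (glue I al be) w = ex al w by rewrite /ex ffunE => ->.
have [->|uv] := eqVneq u v; first by rewrite -gI // (eqP vk).
have [Iu|Iu] := boolP (I u).
  have := iso u; rewrite uv /= gI // implybN => /implyP/(_ Iu).
  by rewrite negbK => /eqP.
by have := forallP h1 u; rewrite (negbTE Iu) /= => /eqP h; rewrite /ex h.
Qed.

Variables (J W : nat) (S : R).
Hypothesis wsum_le : forall a : E -> C, poly_bdd a -> wsum J W a <= S.
Hypothesis S0 : 0 <= S.
Hypothesis a_bdd : poly_bdd a.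

(** Averaging over the colourings costs 2 (2 l + 1) <= 4 j and [pure_hsum_le] a factor 4; the power
    at most 2 turns 16 j into 256 j^2. *)
Lemma dom_sum_le k l : (0 < k <= d)%N -> (l < J)%N ->
  dom_sum (k + l)%N k `^ (hexp R (k + l))^-1 <=
  256 * (k + l)%:R ^+ 2 * ((S * l%:R ^+ W) ^+ l) `^ (k + l)%:R^-1.
Proof.
move=> k0d lJ; have /andP[k0 kd] := k0d; set j := (k + l)%N.
have j0 : (0 < j)%N by rewrite /j addn_gt0 k0.
set Z := (S * _) ^+ l.
have Z0 : 0 <= Z by rewrite exprn_ge0 // mulr_ge0 ?exprn_ge0.
pose Q := Z `^ j.+1%:R^-1.
have Q0 : 0 <= Q by exact: powR_ge0.
set M := (2 * l).+1; pose Col : finType := {ffun 'I_n -> 'I_M}.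
have cardC : #|Col| = (M ^ n)%N by rewrite card_ffun !card_ord.
have Mn : 0 < (M ^ n)%:R :> R by rewrite ltr0n expn_gt0.
pose T (c : Col) := \sum_v \sum_be
  sqm (pure_coef (split_coef (color0 c) a) k l v be) `^ hexp R j.
have T0 c : 0 <= T c by do 2![apply: sumr_ge0 => ? _]; exact: powR_ge0.
have TQ c : T c <= 4 * Q.
  have h := pure_hsum_le k0d (split_bdd (color0 c) a_bdd) wsum_le S0 lJ.
  rewrite -/j -/Z -/(T c) in h.
  rewrite -(@ler_pXn2r _ j.+1) ?nnegrE ?mulr_ge0 //.
  apply: le_trans h _; rewrite exprMn.
  have -> : Q ^+ j.+1 = Z.
    by rewrite /Q -(mulr1 (Z `^ _)) exprn_root_mul // expr1n mulr1.
  by rewrite ler_wpM2r // ler_weXn2l // ler1n.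
have key v al : dg al = j -> ex al v = k ->
    (M ^ n)%:R <= (2 * M)%:R * \sum_(c : Col) (isolates c v (ex al))%:R :> R.
  move=> dj vk; rewrite -natr_sum -natrM ler_nat.
  by apply: card_isolating; rewrite dj vk.
have h : dom_sum j k <= 16 * j%:R * Q.
  rewrite -(ler_pM2r Mn); apply: (@le_trans _ _ ((2 * M)%:R * \sum_(c : Col) T c)).
    apply: (@le_trans _ _ ((2 * M)%:R * \sum_(c : Col) \sum_v
        \sum_(al | (dg al == j) && (ex al v == k))
          (isolates c v (ex al))%:R * sqm (a al) `^ hexp R j)).
      rewrite exchange_big /= mulr_suml mulr_sumr; apply: ler_sum => v _.
      rewrite exchange_big /= mulr_suml mulr_sumr.
      apply: ler_sum => al /andP[/eqP dj /eqP vk].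
      by rewrite -mulr_suml mulrA mulrC ler_wpM2r ?powR_ge0 // key.
    rewrite ler_wpM2l // ler_sum // => c _; apply: ler_sum => v _.
    exact: isolated_le.
  apply: (@le_trans _ _ ((2 * M)%:R * \sum_(c : Col) 4 * Q)).
    by rewrite ler_wpM2l // ler_sum.
  rewrite sumr_const cardC -[(4 * Q) *+ _]mulr_natr mulrA ler_wpM2r // mulrA ler_wpM2r //.
  by rewrite -!natrM ler_nat /M /j; lia.
have j1 : 1 <= 16 * j%:R :> R by rewrite -natrM ler1n muln_gt0.
apply: (@le_trans _ _ ((16 * j%:R * Q) `^ (hexp R j)^-1)).
  apply: ge0_ler_powR h; rewrite ?nnegrE ?invr_ge0 ?hexp_ge0 ?dom_sum_ge0 //.
  by rewrite !mulr_ge0.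
apply: le_trans (powR_hexpV_scale j1 Q0 j0) _.
rewrite exprMn; have -> : 16 ^+ 2 = 256 :> R by rewrite -natrX.
rewrite ler_wpM2l ?mulr_ge0 ?exprn_ge0 // /Q -powRrM /hexp invf_div mulrA.
by rewrite mulVf ?mul1r // pnatr_eq0.
Qed.

End Dominated.

(** * The uniform bound *)

Section Contraction.
Context {R : realType}.
Local Notation C := (R[i]).

Lemma sum_invsq_le J : \sum_(1 <= j < J) (j%:R ^+ 2)^-1 <= 2 :> R.
Proof.
case: J => [|J]; first by rewrite big_geq // ler0n.
have [->|J0] := posnP J; first by rewrite big_geq // ler0n.
(* The sharper bound 2 - 1/J telescopes. *)
suff : \sum_(1 <= j < J.+1) (j%:R ^+ 2)^-1 <= 2 - J%:R^-1 :> R.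
  by move=> /le_trans; apply; rewrite lerBlDr lerDl invr_ge0.
elim: J J0 => // J IH _; have [->|J0] := posnP J.
  by rewrite big_nat1 expr1n invr1; lra.
rewrite big_nat_recr //=; apply: le_trans (lerD (IH J0) (lexx _)) _.
have J1 : 0 < J%:R :> R by rewrite ltr0n.
have -> : J.+1%:R = J%:R + 1 :> R by rewrite natr1.
move: J1; set x := J%:R => x0.
have x1 : 0 < x + 1 by lra.
rewrite -subr_ge0.
have -> : 2 - (x + 1)^-1 - (2 - x^-1 + ((x + 1) ^+ 2)^-1) =
   (x * (x + 1) ^+ 2)^-1.
  by field; rewrite ?gt_eqF.
by rewrite invr_ge0 mulr_ge0 ?exprn_ge0 ?ltW.
Qed.

(** Repeated squaring with rounding to hundredths shows (31/32)^64 <= 1/2. *)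
Lemma ratio_pow_le be : (31%:R / 32%:R) ^+ (64 * (5 + be)) <= 2^-1 ^+ be :> R.
Proof.
set q : R := _ / _.
have q0 : 0 <= q by rewrite divr_ge0.
have sq x (c : R) : 0 <= x -> x <= c -> x ^+ 2 <= c ^+ 2 :> R.
  by move=> x0 xc; apply: lerXn2r; rewrite ?nnegrE // (le_trans x0).
have q1 : q <= 97%:R / 100%:R by rewrite /q; lra.
have q2 : q ^+ 2 <= 95%:R / 100%:R by apply: le_trans (sq _ _ q0 q1) _; lra.
have q4 : q ^+ 4 <= 91%:R / 100%:R.
  by rewrite (exprM q 2 2); apply: le_trans (sq _ _ (exprn_ge0 _ q0) q2) _; lra.
have q8 : q ^+ 8 <= 83%:R / 100%:R.
  by rewrite (exprM q 4 2); apply: le_trans (sq _ _ (exprn_ge0 _ q0) q4) _; lra.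
have q16 : q ^+ 16 <= 69%:R / 100%:R.
  by rewrite (exprM q 8 2); apply: le_trans (sq _ _ (exprn_ge0 _ q0) q8) _; lra.
have q32 : q ^+ 32 <= 48%:R / 100%:R.
  by rewrite (exprM q 16 2); apply: le_trans (sq _ _ (exprn_ge0 _ q0) q16) _; lra.
have q64 : q ^+ 64 <= 2^-1.
  by rewrite (exprM q 32 2); apply: le_trans (sq _ _ (exprn_ge0 _ q0) q32) _; lra.
have h : q ^+ (64 * (5 + be)) <= 2^-1 ^+ (5 + be).
  rewrite exprM; apply: lerXn2r; rewrite ?nnegrE ?exprn_ge0 ?invr_ge0 //.
apply: le_trans h _; apply: ler_wiXn2l; rewrite ?invr_ge0 ?leq_addl //.
by lra.
Qed.

Variables (n d : nat).
Local Notation E := {ffun 'I_n -> 'I_d.+1}.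
Local Notation dg a := (deg (ex a)).
Variables (J be W : nat).
Hypothesis WE : W = (64 * (5 + be))%N.
Variable S : R.
Hypothesis wsum_le : forall a : E -> C, poly_bdd a -> wsum J W a <= S.
Hypothesis S1 : 1 <= S.
Variable a : E -> C.
Hypothesis a_bdd : poly_bdd a.

Definition hsum_dom j : R :=
  \sum_(al | (dg al == j) && ~~ spread j al) sqm (a al) `^ hexp R j.

(** A union bound over the variable carrying the large exponent; a monomial with several large
    exponents is counted several times. *)
Lemma hsum_dom_le j : (0 < j)%N ->
  hsum_dom j <=
  \sum_(k < j | (j <= 64 * k.+1)%N && (k < d)%N) dom_sum a j k.+1.
Proof.
move=> j0; rewrite /dom_sum.
have -> : \sum_(k < j | (j <= 64 * k.+1)%N && (k < d)%N) \sum_v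
    \sum_(al | (dg al == j) && (ex al v == k.+1)) sqm (a al) `^ hexp R j =
  \sum_al \sum_(k < j | (j <= 64 * k.+1)%N && (k < d)%N) \sum_v
    if (dg al == j) && (ex al v == k.+1) then sqm (a al) `^ hexp R j else 0.
  rewrite [RHS]exchange_big; apply: eq_bigr => k _.
  by rewrite [RHS]exchange_big; apply: eq_bigr => v _; rewrite big_mkcond.
rewrite /hsum_dom big_mkcond; apply: ler_sum => al _.
have p0 k v : 0 <= if (dg al == j) && (ex al v == k)
    then sqm (a al) `^ hexp R j else 0.
  by case: ifP => // _; exact: powR_ge0.
case: ifP => [/andP[/eqP dj]|_]; last first.
  by apply: sumr_ge0 => k _; apply: sumr_ge0 => v _; exact: p0.
rewrite negb_forall => /existsP[v]; rewrite -leqNgt => jv.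
have v0 : (0 < ex al v)%N by move: jv j0; case: (ex al v) => //; lia.
have vj : (ex al v <= j)%N by rewrite -dj /deg (bigD1 v) //= leq_addr.
have kj : ((ex al v).-1 < j)%N by rewrite prednK.
rewrite (bigD1 (Ordinal kj)) /=; last first.
  by rewrite prednK // jv /= -ltnS ltn_ord.
rewrite prednK // (bigD1 v) //= dj eqxx eqxx /= -addrA lerDl addr_ge0 //.
  by apply: sumr_ge0 => u _; case: ifP => // _; exact: powR_ge0.
do 2![apply: sumr_ge0 => ? _]; by case: ifP => // _; exact: powR_ge0.
Qed.

(** For l > 0 one has j >= 2, S^(l/j) <= S and l^(W l/j) <= j^(63 W/64), which leaves j^(5 + be) in
    the denominator. The indicator stands for l = 0, a case free of S that occurs for a single k at
    each j. *)
Lemma dom_term_le j l : (0 < j)%N -> (64 * l <= 63 * j)%N ->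
  ((S * l%:R ^+ W) ^+ l) `^ j%:R^-1 / j%:R ^+ W <=
  ((l == 0%N)%:R + S * 2^-1 ^+ be) / j%:R ^+ 5.
Proof.
move=> j0 lj; have jR : 0 < j%:R :> R by rewrite ltr0n.
have j1 : 1 <= j%:R :> R by rewrite ler1n.
have S0 : 0 <= S by rewrite (le_trans _ S1).
have [l0|l0] := posnP l.
  rewrite l0 expr0 powR1 mulrDl -[leLHS]addr0 lerD //; last first.
    by rewrite divr_ge0 ?mulr_ge0 ?exprn_ge0 ?invr_ge0.
  rewrite !mul1r lef_pV2 ?posrE ?exprn_gt0 // ler_weXn2l // WE; lia.
have j2 : (2 <= j)%N by lia.
rewrite add0r.
have [p pE] : exists p, p = (63 * (5 + be))%N by exists (63 * (5 + be))%N.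
have h : ((S * l%:R ^+ W) ^+ l) `^ j%:R^-1 <= S * j%:R ^+ p.
  have root (z : R) : 0 <= z -> z = (z ^+ j) `^ j%:R^-1.
    by move=> z0; rewrite -powR_mulrn // -powRrM mulfV ?gt_eqF // powRr1.
  rewrite [leRHS]root ?mulr_ge0 ?exprn_ge0 //.
  apply: ge0_ler_powR; rewrite ?nnegrE ?invr_ge0 ?exprn_ge0 ?mulr_ge0 ?exprn_ge0 //.
  rewrite !exprMn; apply: ler_pM; rewrite ?exprn_ge0 //.
    by apply: ler_weXn2l => //; lia.
  rewrite -!exprM; apply: (@le_trans _ _ (j%:R ^+ (W * l))).
    apply: lerXn2r; rewrite ?nnegrE // ler_nat; lia.
  apply: ler_weXn2l => //.
  by have := leq_mul (leqnn (5 + be)) lj; rewrite WE pE; lia.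
rewrite ler_pdivrMr ?exprn_gt0 //; apply: le_trans h _.
have -> : W = (p + be + 5)%N by rewrite WE pE; lia.
rewrite !exprD; set x := j%:R ^+ p.
have x0 : 0 <= x by rewrite exprn_ge0.
have j5 : j%:R ^+ 5 != 0 :> R by rewrite gt_eqF // exprn_gt0.
have -> : S * 2^-1 ^+ be / j%:R ^+ 5 * (x * j%:R ^+ be * j%:R ^+ 5) =
    S * x * (2^-1 * j%:R) ^+ be.
  rewrite exprMn; move: (2^-1 ^+ be) (j%:R ^+ be) (j%:R ^+ 5) j5 => u v w w0.
  by field.
rewrite ler_peMr ?mulr_ge0 // exprn_ege1 // mulrC ler_pdivlMr // mul1r.
by rewrite ler_nat.
Qed.

Lemma dom_sum_total_le :
  \sum_(1 <= j < J) hsum_dom j `^ (hexp R j)^-1 / j%:R ^+ W <=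
  1024 * (1 + S * 2^-1 ^+ be).
Proof.
have S0 : 0 <= S by rewrite (le_trans _ S1).
have e0 : 0 <= S * 2^-1 ^+ be by rewrite mulr_ge0 ?exprn_ge0 ?invr_ge0.
set eps := S * 2^-1 ^+ be in e0 *.
(* At each j the exponents k contribute in total 512 j^2 (1 + eps j) / j^5, at most 512 (1 + eps) /
   j^2. *)
apply: (@le_trans _ _ (\sum_(1 <= j < J) 512 * (1 + eps) * (j%:R ^+ 2)^-1)).
  apply: ler_sum_nat => j /andP[j0 jJ].
  have jR : 0 < j%:R :> R by rewrite ltr0n.
  have j1 : 1 <= j%:R :> R by rewrite ler1n.
  have jW : 0 <= (j%:R ^+ W)^-1 :> R by rewrite invr_ge0 exprn_ge0.
  pose G (k : 'I_j) : R := if (j <= 64 * k.+1)%N && (k < d)%N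
    then dom_sum a j k.+1 else 0.
  have G0 k : 0 <= G k by rewrite /G; case: ifP => // _; exact: dom_sum_ge0.
  have h1 : hsum_dom j `^ (hexp R j)^-1 <= 2 * \sum_k G k `^ (hexp R j)^-1.
    apply: le_trans (powR_sum_hexp j0 G0 _); last by rewrite card_ord.
    apply: ge0_ler_powR; rewrite ?nnegrE ?invr_ge0 ?hexp_ge0 ?sumr_ge0 //.
      by move=> al _; exact: powR_ge0.
    by apply: le_trans (hsum_dom_le j0) _; rewrite big_mkcond.
  apply: le_trans (ler_wpM2r jW h1) _.
  have h2 (k : 'I_j) : G k `^ (hexp R j)^-1 / j%:R ^+ W <=
      256 * j%:R ^+ 2 * (((j - k.+1)%N == 0%N)%:R + eps) / j%:R ^+ 5.
    have rhs0 : 0 <= 256 * j%:R ^+ 2 * (((j - k.+1)%N == 0%N)%:R + eps) / j%:R ^+ 5.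
      rewrite divr_ge0 ?exprn_ge0 // mulr_ge0 // ?addr_ge0 //.
      by rewrite mulr_ge0 // exprn_ge0.
    rewrite /G; case: ifP => [/andP[jk kd]|_]; last first.
      by rewrite powR0 ?mul0r // invr_eq0 gt_eqF // hexp_gt0.
    have jE : (k.+1 + (j - k.+1) = j)%N by rewrite subnKC.
    have lJ : (j - k.+1 < J)%N by apply: leq_ltn_trans jJ; exact: leq_subr.
    have k0d : (0 < k.+1 <= d)%N by [].
    have := dom_sum_le wsum_le S0 a_bdd k0d lJ; rewrite jE => h.
    have {}h := ler_wpM2r jW h.
    apply: (le_trans h).
    have c0 : 0 <= 256 * j%:R ^+ 2 :> R by rewrite mulr_ge0 // exprn_ge0.
    rewrite -[leLHS]mulrA -[leRHS]mulrA; apply: (ler_wpM2l c0).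
    by apply: dom_term_le => //; move: jk (ltn_ord k); clear; lia.
  rewrite -[leLHS]mulrA mulr_suml.
  apply: (@le_trans _ _ (2 * \sum_(k < j)
      256 * j%:R ^+ 2 * (((j - k.+1)%N == 0%N)%:R + eps) / j%:R ^+ 5)).
    by rewrite ler_wpM2l // ler_sum // => k _; exact: h2.
  rewrite -mulr_suml -mulr_sumr big_split /=.
  have -> : \sum_(k < j) ((j - k.+1)%N == 0%N)%:R = 1 :> R.
    case: j j0 {h1 h2 jJ jR j1 jW G G0} => // j _; rewrite big_ord_recr /= subnn eqxx.
    by rewrite big1 ?add0r // => k _; rewrite subn_eq0 ltnNge ltn_ord.
  rewrite sumr_const card_ord -[eps *+ _]mulr_natr.
  have -> : 512 * (1 + eps) * (j%:R ^+ 2)^-1 =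
     2 * (256 * j%:R ^+ 2 * (j%:R + eps * j%:R) / j%:R ^+ 5) :> R.
    by field; rewrite gt_eqF.
  rewrite ler_wpM2l // ler_wpM2r ?invr_ge0 ?exprn_ge0 //.
  by rewrite ler_wpM2l ?mulr_ge0 ?exprn_ge0 // lerD2r.
rewrite -mulr_sumr.
have -> : 1024 * (1 + eps) = 512 * (1 + eps) * 2 :> R by ring.
by rewrite ler_wpM2l ?sum_invsq_le // mulr_ge0 // addr_ge0.
Qed.

Lemma wsum_contract : wsum J W a <= 4096 + 4 ^+ 66 * 2^-1 ^+ be * S.
Proof.
have S0 : 0 <= S by rewrite (le_trans _ S1).
have sp := spread_sum_le wsum_le a_bdd.
have dm := dom_sum_total_le.
apply: (@le_trans _ _ (4 * (16 * ((31%:R / 32%:R) ^+ W * ((4 ^+ 31) ^+ 2 * S))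
   + 1024 * (1 + S * 2^-1 ^+ be)))).
  apply: le_trans (ler_wpM2l _ (lerD sp dm)); last by [].
  rewrite -big_split mulr_sumr /wsum; apply: ler_sum_nat => j /andP[j0 jJ].
  rewrite /= -mulrDl mulrA ler_wpM2r ?invr_ge0 ?exprn_ge0 //.
  have -> : hsum a j = hsum_spread a j + hsum_dom j.
    by rewrite /hsum (bigID (spread j)).
  have x0 : 0 <= hsum_spread a j by apply: sumr_ge0 => al _; exact: powR_ge0.
  have y0 : 0 <= hsum_dom j by apply: sumr_ge0 => al _; exact: powR_ge0.
  move: x0 y0; set x := hsum_spread a j; set y := hsum_dom j => x0 y0.
  clearbody x y.
  have ie0 : 0 <= (hexp R j)^-1 by rewrite invr_ge0 hexp_ge0.
  (* Here u + v is at most twice the larger term, and the power is at most 2. *)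
  have m (u v : R) : 0 <= u -> u <= v -> u + v <= 2 * v -> 0 <= v ->
      (u + v) `^ (hexp R j)^-1 <= 4 * (u `^ (hexp R j)^-1 + v `^ (hexp R j)^-1).
    move=> u0 uv uv2 v0.
    apply: (@le_trans _ _ ((2 * v) `^ (hexp R j)^-1)).
      by apply: ge0_ler_powR; rewrite ?nnegrE ?addr_ge0 ?mulr_ge0.
    apply: le_trans (powR_hexpV_scale _ v0 j0) _; first by rewrite ler1n.
    by rewrite -natrX ler_wpM2l // lerDr powR_ge0.
  have [xy|/ltW yx] := leP x y; first by apply: m => //; lra.
  by rewrite addrC [X in 4 * X]addrC; apply: m => //; lra.
have := ratio_pow_le be; rewrite -WE => r.
have p0 : 0 <= 2^-1 ^+ be :> R by rewrite exprn_ge0 // invr_ge0.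
have K0 : 0 <= (4 ^+ 31) ^+ 2 * S by rewrite mulr_ge0 ?exprn_ge0.
apply: (@le_trans _ _ (4 * (16 * (2^-1 ^+ be * ((4 ^+ 31) ^+ 2 * S))
   + 1024 * (1 + S * 2^-1 ^+ be)))).
  by rewrite ler_wpM2l // lerD2r ler_wpM2l // ler_wpM2r.
have -> : (4 ^+ 31) ^+ 2 = 4 ^+ 62 :> R by rewrite -exprM.
(* The terms with S add up to (64 * 4^62 + 4096) 2^(-be) S, which fits under 256 * 4^62 since 4096
   <= 4^62. *)
have -> : 4 ^+ 66 = 256 * 4 ^+ 62 :> R by rewrite (exprD 4 4 62); congr (_ * _); ring.
have X1 : 4096 <= 4 ^+ 62 :> R.
  have -> : 4096 = 4 ^+ 6 :> R by rewrite -natrX.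
  by rewrite ler_weXn2l // ler1n.
have t0 : 0 <= 2^-1 ^+ be * S by rewrite mulr_ge0.
move: X1 t0; move: (4 ^+ 62) (2^-1 ^+ be) => X p X1 t0.
have Xt : 0 <= (X - 4096) * (p * S) by rewrite mulr_ge0 // subr_ge0.
have Xt0 : 0 <= X * (p * S) by rewrite mulr_ge0 // (le_trans _ X1).
move: Xt Xt0; rewrite mulrBl; lra.
Qed.

End Contraction.

From mathcomp Require Import classical_sets ereal.

(** * A priori finiteness and the absolute bound *)

Section Bound.
Local Open Scope classical_set_scope.
Context {R : realType}.
Local Notation C := (R[i]).
Variables (n d J : nat).
Local Notation E := {ffun 'I_n -> 'I_d.+1}.

Lemma coef_le1 (a : E -> C) al : poly_bdd a -> sqm (a al) <= 1.
Proof.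
move=> a_bdd.
have [w pw] := @prim_root_exists R (d + d).+1 (ltn0Sn _).
have eN (be : E) v : (ex be v + ex be v < (d + d).+1)%N.
  by rewrite ltnS leq_add // -ltnS ltn_ord.
have h := sum_sqm_lincomb pw (@ex_inj n d) eN a.
have N0 : 0 < ((d + d).+1 ^ n)%:R :> R by rewrite ltr0n expn_gt0.
apply: (@le_trans _ _ (\sum_be sqm (a be))).
  by rewrite (bigD1 al) //= lerDl sumr_ge0 // => be _; exact: sqm_ge0.
rewrite -(ler_pM2l N0) -h mulr1.
have -> : ((d + d).+1 ^ n)%:R =
    \sum_(y : {ffun 'I_n -> 'I_(d + d).+1}) (1 : R).
  by rewrite sumr_const card_ffun !card_ord.
apply: ler_sum => y _; rewrite exprn_ile1 ?normc_ge0 //.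
by apply: a_bdd; exact: inD_tpt pw.
Qed.

(** A crude bound depending on [n], [d] and [J]; it serves to make the supremum in [wsum_uniform]
    finite. *)
Lemma wsum_bounded W : exists M : R, forall a : E -> C, poly_bdd a ->
  wsum J W a <= M.
Proof.
exists (\sum_(1 <= j < J) #|{: E}|%:R `^ (hexp R j)^-1 / j%:R ^+ W) => a a_bdd.
apply: ler_sum => j _; rewrite ler_wpM2r ?invr_ge0 ?exprn_ge0 //.
apply: ge0_ler_powR; rewrite ?nnegrE ?invr_ge0 ?hexp_ge0 ?hsum_ge0 //.
rewrite /hsum -sum1_card natr_sum big_mkcond /=; apply: ler_sum => al _.
case: ifP => // _; apply: (@le_trans _ _ (1 `^ hexp R j)); last by rewrite powR1.
by apply: ge0_ler_powR; rewrite ?nnegrE ?hexp_ge0 ?sqm_ge0 ?coef_le1.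
Qed.

Lemma wsum_uniform W (a : E -> C) : W = (64 * (5 + 133))%N -> poly_bdd a ->
  wsum J W a <= 8192.
Proof.
move=> WE a_bdd.
pose A := [set x : R | exists2 a : E -> C, poly_bdd a & x = wsum J W a].
have [M MA] := wsum_bounded W.
have supA : has_sup A.
  split; first by exists (wsum J W a), a.
  by exists M => _ [a' a'_bdd ->]; exact: MA.
(* The maximum with 1 meets the hypothesis 1 <= S of [wsum_contract], where S^(l/j) is replaced by
   S. *)
pose S : R := Order.max 1 (sup A).
have leS (a' : E -> C) : poly_bdd a' -> wsum J W a' <= S.
  move=> a'_bdd; rewrite le_max; apply/orP; right.
  by apply: sup_upper_bound => //; exists a'.
have S1 : 1 <= S by rewrite le_max lexx.
have half : 4 ^+ 66 * 2^-1 ^+ 133 = 2^-1 :> R.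
  have -> : 4 = 2 ^+ 2 :> R by rewrite -natrX.
  rewrite -exprM exprVn -[133%N]/(2 * 66 + 1)%N [2 ^+ (_ + 1)]exprD expr1 invfM.
  by rewrite mulrA mulfV ?mul1r // expf_neq0 // pnatr_eq0.
have contr (a' : E -> C) : poly_bdd a' -> wsum J W a' <= 4096 + 2^-1 * S.
  move=> a'_bdd; have := wsum_contract WE leS S1 a'_bdd.
  by rewrite half.
have : S <= 4096 + 2^-1 * S.
  rewrite {1}/S ge_max; apply/andP; split; first by move: S1; lra.
  apply: ge_sup; first by case: supA.
  by move=> _ [a' a'_bdd ->]; exact: contr.
by have := leS _ a_bdd; lra.
Qed.

End Bound.

Lemma wsum_absolute_bound (R : realType) : exists (W : nat) (K : R), 1 <= K /\
  forall n d J (a : {ffun 'I_n -> 'I_d.+1} -> R[i]),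
    poly_bdd a -> wsum J W a <= K.
Proof.
exists (64 * (5 + 133))%N, 8192; split; first by rewrite ler1n.
by move=> n d J a; exact: wsum_uniform.
Qed.

(** * Homogeneous polynomials and the open polydisc *)

Section Homogeneous.
Local Open Scope classical_set_scope.
Context {R : realType}.
Local Notation C := (R[i]).
Variables (n m : nat) (P : {mpoly C[n]}).
Hypothesis m0 : (0 < m)%N.
Hypothesis P_homog : P \is m.-homog.
Local Notation E := {ffun 'I_n -> 'I_m.+1}.

(** Exponents in an m-homogeneous polynomial are at most m, so multi-indices with d = m cover its
    support. *)
Definition mnm_of (al : E) : 'X_{1..n} := [multinom ex al v | v < n].

Definition coef_of (al : E) : C := P@_(mnm_of al).

Lemma msupp_mdeg u : u \in msupp P -> mdeg u = m.
Proof. by move=> uP; move/dhomogP: P_homog => /(_ _ uP). Qed.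

Lemma mdeg_mnm_of al : mdeg (mnm_of al) = deg (ex al).
Proof. by rewrite mdegE; apply: eq_bigr => v _; rewrite mnmE. Qed.

Lemma sum_msupp (V : nmodType) (F : 'X_{1..n} -> V) :
  (forall u, u \notin msupp P -> F u = 0) ->
  \sum_(u <- msupp P) F u = \sum_al F (mnm_of al).
Proof.
move=> F0.
have inj : injective mnm_of.
  move=> al be h; apply: ex_inj => v.
  by have := congr1 (fun u : 'X_{1..n} => u v) h; rewrite !mnmE.
have -> : \sum_al F (mnm_of al) =
    \sum_(u <- [seq mnm_of al | al <- index_enum E]) F u by rewrite big_map.
rewrite [RHS](bigID (mem (msupp P))) /= [X in _ + X]big1 ?addr0; last first.
  by move=> u; exact: F0.
rewrite -[RHS]big_filter; apply: perm_big; apply: uniq_perm.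
- exact: msupp_uniq.
- by rewrite filter_uniq // map_inj_uniq // index_enum_uniq.
move=> u; rewrite mem_filter; case: (boolP (u \in msupp P)) => //= uP.
have du := msupp_mdeg uP.
have um v : (u v < m.+1)%N.
  by rewrite ltnS -du mdegE (bigD1 v) //= leq_addr.
apply/esym/mapP; exists [ffun v => Ordinal (um v)]; first by rewrite mem_index_enum.
by apply/mnmP => v; rewrite mnmE /ex ffunE.
Qed.

Lemma coef_of_deg al : deg (ex al) != m -> coef_of al = 0.
Proof.
move=> dm; apply: memN_msupp_eq0; apply: contra dm => alP.
by rewrite -mdeg_mnm_of msupp_mdeg.
Qed.

Lemma meval_coef_of z : P.@[z] = lincomb ex coef_of z.
Proof.
rewrite mevalE sum_msupp => [|u uP]; last by rewrite memN_msupp_eq0 // mul0r.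
apply: eq_bigr => al _; congr (_ * _).
by apply: eq_bigr => v _; rewrite mnmE.
Qed.

Lemma meval_scale (r : R) z : P.@[fun v => r%:C%C * z v] = r%:C%C ^+ m * P.@[z].
Proof.
rewrite !meval_coef_of /lincomb mulr_sumr; apply: eq_bigr => al _.
have [dm|dm] := eqVneq (deg (ex al)) m; last first.
  by rewrite coef_of_deg // !mul0r mulr0.
by rewrite monM mon_const dm mulrCA.
Qed.

Lemma bernoulli_le (x : R) k : 0 <= x <= 1 -> 1 - k%:R * x <= (1 - x) ^+ k.
Proof.
move=> /andP[x0 x1]; elim: k => [|k IH]; first by rewrite mul0r subr0 expr0.
have h : 0 <= 1 - x by rewrite subr_ge0.
rewrite exprS; apply: le_trans (ler_wpM2l h IH).
rewrite -natr1; set y := k%:R; have : 0 <= y * (x * x) by rewrite !mulr_ge0.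
nra.
Qed.

(** Homogeneity replaces continuity at the boundary: r^m |P(z)| <= M for every r < 1. *)
Lemma normc_meval_le z : inD z -> normc P.@[z] <= sup_norm P.
Proof.
move=> zD; set N := normc _; set M := sup_norm P.
have M0 : 0 <= M.
  apply: le_trans (normc_ge0 P.@[fun=> 0]) _.
  apply: (sup_upper_bound (has_sup_polydisc P)).
  by exists (fun=> 0) => // v; rewrite normc0.
have rN (r : R) : 0 <= r < 1 -> r ^+ m * N <= M.
  move=> /andP[r0 r1]; rewrite /N -[r in r ^+ m](normc_real r0).
  rewrite -normcX -normcM -meval_scale.
  apply: (sup_upper_bound (has_sup_polydisc P)).
  exists (fun v => r%:C%C * z v) => // v; rewrite normcM normc_real //.
  by apply: le_lt_trans r1; rewrite ler_piMr.
have N0 : 0 <= N by exact: normc_ge0.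
rewrite leNgt; apply/negP => MN.
have Np : 0 < N by exact: le_lt_trans MN.
have mR : 1 <= m%:R :> R by rewrite ler1n.
(* Chosen so that m t N = (N - M)/2; Bernoulli's inequality then gives (1 - t)^m N >= (N + M)/2 >
   M. *)
pose t := (N - M) / (2 * m%:R * N).
have mN : 0 < 2 * m%:R * N by rewrite !mulr_gt0 // (lt_le_trans _ mR).
have tp : 0 < t by rewrite divr_gt0 // subr_gt0.
have t1 : t <= 1.
  by rewrite ler_pdivrMr // mul1r; nra.
have h1 : (1 - t) ^+ m * N <= M by apply: rN; lra.
have tE : m%:R * t * N = (N - M) / 2.
  by rewrite /t; field; rewrite !gt_eqF // (lt_le_trans _ mR).
have h2 : (1 - m%:R * t) * N <= (1 - t) ^+ m * N.
  by rewrite ler_wpM2r // bernoulli_le // t1 ltW.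
have h3 : (1 - m%:R * t) * N = N - m%:R * t * N by rewrite mulrBl mul1r.
move: h2; rewrite h3 tE; lra.
Qed.

Lemma coef_norm_hsum :
  coef_norm (BH_exponent R m) P = hsum coef_of m `^ (BH_exponent R m)^-1.
Proof.
have pE : BH_exponent R m = 2 * hexp R m by rewrite /BH_exponent natrM mulrA.
have h0 : hexp R m != 0 by rewrite gt_eqF // hexp_gt0.
congr (_ `^ _); rewrite sum_msupp => [|u uP]; last first.
  by rewrite memN_msupp_eq0 // normc0 powR0 // pE mulf_neq0 // pnatr_eq0.
rewrite /hsum [RHS]big_mkcond; apply: eq_bigr => al _.
rewrite pE -sqm_powR -/(coef_of al); case: ifPn => // /coef_of_deg ->.
by rewrite sqm0 powR0.
Qed.

Lemma coef_norm_le W (K : R) : 1 <= K ->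
  (forall a : E -> C, poly_bdd a -> wsum m.+1 W a <= K) ->
  coef_norm (BH_exponent R m) P / sup_norm P <= K * m%:R ^+ W.
Proof.
move=> K1 wsum_K; set M := sup_norm P.
have mW : 1 <= m%:R ^+ W :> R by rewrite exprn_ege1 // ler1n.
have M0 : 0 <= M.
  apply: le_trans (normc_ge0 P.@[fun=> 0]) _.
  by apply: normc_meval_le => v; rewrite normc0.
have [->|Mn0] := eqVneq M 0.
  (* The inverse of 0 is 0, so the quotient is 0 here. *)
  rewrite invr0 mulr0; apply: mulr_ge0; first exact: le_trans ler01 K1.
  exact: le_trans ler01 mW.
have Mp : 0 < M by rewrite lt_neqAle eq_sym Mn0.
pose a al := coef_of al * (M%:C%C)^-1.
have nM : normc (M%:C%C)^-1 = M^-1 by rewrite normcV normc_real.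
have a_bdd : poly_bdd a.
  move=> z zD; have -> : lincomb ex a z = P.@[z] * (M%:C%C)^-1.
    rewrite meval_coef_of /lincomb mulr_suml; apply: eq_bigr => al _.
    by rewrite mulrAC.
  by rewrite normcM nM ler_pdivrMr // mul1r normc_meval_le.
have p0 : 0 < BH_exponent R m by rewrite divr_gt0 ?ltr0n // muln_gt0.
have h0 : hexp R m != 0 by rewrite gt_eqF // hexp_gt0.
have pE : BH_exponent R m = 2 * hexp R m by rewrite /BH_exponent natrM mulrA.
have -> : coef_norm (BH_exponent R m) P / M =
    (hsum a m `^ (hexp R m)^-1) `^ 2^-1.
  have -> : hsum a m = hsum coef_of m / M `^ BH_exponent R m.
    rewrite /hsum mulr_suml; apply: eq_bigr => al _.
    rewrite /a !sqm_powR -pE normcM nM.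
    by rewrite powR_div ?normc_ge0.
  rewrite coef_norm_hsum -powRrM -invfM [hexp R m * 2]mulrC -pE.
  rewrite powR_div ?hsum_ge0 ?powR_ge0 // -powRrM mulfV ?gt_eqF //.
  by rewrite powRr1.
have mJ : (0 < m < m.+1)%N by rewrite m0 /=.
have h1 := wsum_term_le W a mJ.
have KW : 1 <= K * m%:R ^+ W by rewrite mulr_ege1.
have KW0 : 0 <= K * m%:R ^+ W by exact: le_trans ler01 KW.
have h3 : hsum a m `^ (hexp R m)^-1 <= K * m%:R ^+ W.
  by apply: le_trans h1 _; rewrite ler_wpM2r ?wsum_K.
apply: (@le_trans _ _ ((K * m%:R ^+ W) `^ 2^-1)).
  by apply: ge0_ler_powR h3; rewrite ?nnegrE ?powR_ge0 ?invr_ge0.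
by apply: ler1_powR => //; rewrite invf_le1 // ler1n.
Qed.

End Homogeneous.

Theorem theorem1p1 (R : realType) :
  exists B0 K : R, forall m : nat, (1 <= m)%N ->
    (BH_const R m <= (K * m%:R `^ B0)%:E)%E.
Proof.
have [W [K [K1 wsum_K]]] := wsum_absolute_bound R.
exists W%:R, K => m m1; rewrite powR_mulrn //.
apply: ge_ereal_sup => _ [n n1 <-]; apply: ge_ereal_sup => _ [P [_ Phom] <-].
rewrite lee_fin; apply: coef_norm_le => // a; exact: wsum_K.
Qed.
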